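(* Let $1\le m\le n$, let $$Y=\left\{p_{i,m}=(ih,mh):\ i=1,\ldots,\tfrac n2\right\},\qquad X=\left\{p_{i,m}=(ih,mh):\ i=\tfrac n2+1,\ldots,n\right\},$$ and let $G$ be the (continuous) half-space Green's function of the Helmholtz operator $\Delta+\omega^2$ (constant velocity field $c(x)=1$) for the domain $(-\infty,\infty)\times(-\infty,(m+1)h)$ with zero Dirichlet boundary condition on $x_2=(m+1)h$. Then the matrix $(G(x,y))_{x\in X,\,y\in Y}$ is numerically low-rank in the following precise sense: for any $\varepsilon>0$ there exist an integer $$R=O\big(\log\omega\,|\log\varepsilon|^2\big),$$ functions $\{\alpha_r(x)\}_{1\le r\le R}$ on $X$ and functions $\{\beta_r(y)\}_{1\le r\le R}$ on $Y$ such that $$\left|G(x,y)-\sum_{r=1}^R\alpha_r(x)\beta_r(y)\right|\le\varepsilon\qquad\text{for all }x\in X,\ y\in Y.$$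
   Context: Setting. $\omega>0$ is the angular frequency and $\lambda=2\pi/\omega$ the wavelength. The unit square $(0,1)^2$ is discretized by a Cartesian grid with spacing $h=1/(n+1)$ and interior points $p_{i,j}=(ih,jh)$, $1\le i,j\le n$, where $n$ is an integer power of two (in particular even). The number $n$ is proportional to $\omega$: the number of grid points per wavelength, $p=\lambda/h=2\pi(n+1)/\omega$, is bounded above and below by positive constants independent of $\omega$. Green's function. $G$ is the outgoing (Sommerfeld radiation condition) Green's function. With the multiplicative constant of the free-space fundamental solution dropped, it is $$G(x,y)=H_0(\omega|x-y|)-H_0(\omega|x-\mathcal M(y)|),$$ where $H_0$ is the Hankel function of the first kind of order $0$, $|\cdot|$ is the Euclidean norm on $\mathbb R^2$, and $\mathcal M(y)=(y_1,\,2(m+1)h-y_2)$ is the mirror image of $y=(y_1,y_2)$ with respect to the line $x_2=(m+1)h$. Meaning of the $O$-notation. $R=O(\log\omega\,|\log\varepsilon|^2)$ means that there are constants $C>0$, $\omega_0>1$ and $\varepsilon_0\in(0,1)$, depending only on the bounds for the number $p$ of points per wavelength and not on $\omega$, $n$, $m$ or $\varepsilon$, such that $R\le C\log\omega\,|\log\varepsilon|^2$ whenever $\omega\ge\omega_0$ and $0<\varepsilon\le\varepsilon_0$. The functions $\alpha_r$, $\beta_r$ are complex-valued and may depend on $\omega$, $n$, $m$, $\varepsilon$. *)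

(* Defs.v *)
From Stdlib Require Import Reals Lra Lia Arith.
From Coquelicot Require Import Coquelicot.
Open Scope R_scope.

Definition harmonic (k : nat) : R := sum_n_m (fun j : nat => / INR j) 1 k.

Definition euler_gamma : R :=
  real (Lim_seq (fun k : nat => harmonic k - ln (INR k))).

(* Classical ascending series of the Bessel functions of order 0, as power
   series in x^2/4; the one for bessel_Y0 is meant for x > 0. *)
Definition bessel_J0 (x : R) : R :=
  PSeries (fun k : nat => (-1) ^ k / INR (fact k) ^ 2) ((x / 2) ^ 2).

Definition bessel_Y0 (x : R) : R :=
  2 / PI * (ln (x / 2) + euler_gamma) * bessel_J0 x
  - 2 / PI *
    PSeries (fun k : nat => (-1) ^ k * harmonic k / INR (fact k) ^ 2)
            ((x / 2) ^ 2).

Definition hankel0 (x : R) : C :=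
  (RtoC (bessel_J0 x) + Ci * RtoC (bessel_Y0 x))%C.

Definition dist2 (x y : R * R) : R := dist_euc (fst x) (snd x) (fst y) (snd y).

Definition spacing (n : nat) : R := 1 / (INR n + 1).

Definition gridpt (n i j : nat) : R * R :=
  (INR i * spacing n, INR j * spacing n).

Definition wavelength (omega : R) : R := 2 * PI / omega.

Definition points_per_wavelength (omega : R) (n : nat) : R :=
  wavelength omega / spacing n.

Definition mirror (n m : nat) (y : R * R) : R * R :=
  (fst y, 2 * (INR m + 1) * spacing n - snd y).

(* The constant factor of the free-space fundamental solution is dropped.
   Only meaningful off the diagonal x = y. *)
Definition green (omega : R) (n m : nat) (x y : R * R) : C :=
  (hankel0 (omega * dist2 x y) - hankel0 (omega * dist2 x (mirror n m y)))%C.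

Definition setY (n m : nat) (y : R * R) : Prop :=
  exists i : nat, (1 <= i <= n / 2)%nat /\ y = gridpt n i m.

Definition setX (n m : nat) (x : R * R) : Prop :=
  exists i : nat, (n / 2 + 1 <= i <= n)%nat /\ x = gridpt n i m.

(* Main.v *)
Require Import Defs.
From Stdlib Require Import Reals Lra Lia Arith ClassicalEpsilon.
From Coquelicot Require Import Coquelicot.
Open Scope R_scope.

(** With [kappa = omega h = 2 pi / p], which stays in a fixed compact interval, the entry of
    the matrix depends only on [d = a + b >= 1], where [a] is attached to the row and [b] to the column, and is a
    combination of [F d = u (kappa sqrt (d^2 + s))] for [s = 0, 4] and [u = J_0, Y_0].
    Each [F] solves a second order linear ODE with rational coefficients, which has the formal solutions
    [sum_k c_k d^(-k-1/2) cos (kappa d + phi - k pi/2)] with [c_k] growing like [B^k k!].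
    Truncate them after [N ~ |log eps|] terms and match the Cauchy data of [F] at [D = 32 B (N + 1)]:
    the residual is exponentially small in [N], and so is the error on all of [[D, oo)] by an energy
    estimate.  No integral representation and no radiation condition is needed.
    Rows with [a <= D] are kept exactly.  The remaining rows are cut into [O(log n)] strips
    [a0 < a <= 5/4 a0]; there the Taylor expansion of [(a + b)^(-k-1/2)] in [a] about [a0] converges
    geometrically, uniformly in [b >= 0], and each of its terms separates [a] from [b]. *)

(** * Bessel's equation *)

(** The obstacle is that [X] and [Y] nearly touch ([d = 1] occurs) while the expansion in [1/d]
    diverges: with coefficients of size [B^k k!], its terms at [d] are controlled only up to orders
    [k] of about [d / B]. Accuracy [eps] thus forces both an order [N] and a distance [D]
    proportional to [|log eps|]; the rows nearer than [D] are few enough to be paid for in full.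
    Beyond [D], strips of bounded relative width replace the missing separation of [X] and [Y].
    Ranks add over the strips but errors do not, since each row is served by one strip only. The
    square of the logarithm is (orders of the expansion) times (Taylor terms). The constant 32 in
    [D] has two uses. In the residual it beats [(N+1)^3 <= 8^N] and leaves [4^(-N)]; in the Taylor
    step it beats a loss of [2^k] at order [k] and leaves the summable [16^(-k)]. Matching at the
    finite point [D] only bounds the two coefficients by a multiple of [sqrt D], which the
    [d^(-1/2)] decay of the waves cancels. *)

Lemma pow_div_fact_le_exp (x : R) (k : nat) : 0 <= x -> x ^ k / INR (fact k) <= exp x.
Proof.
  intros Hx.
  apply Rle_trans with (2 := exp_ge_taylor x k Hx).
  destruct k as [|k].
  - simpl; lra.
  - rewrite tech5.
    assert (0 <= sum_f_R0 (fun i => x ^ i / INR (fact i)) k); [|lra].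
    apply cond_pos_sum; intros i.
    apply Rmult_le_pos; [now apply pow_le|].
    left; apply Rinv_0_lt_compat, INR_fact_lt_0.
Qed.

(** The terms at any radius [r] are bounded by [exp |r|], and boundedness at [r] already puts [r]
    below the radius of convergence. *)
Lemma CV_radius_fact_bound (a : nat -> R) :
  (forall k, Rabs (a k) <= / INR (fact k)) -> CV_radius a = p_infty.
Proof.
  intros Ha.
  destruct (CV_radius_bounded a) as [Hub _].
  assert (Hr : forall r : R, Rbar_le r (CV_radius a)).
  { intros r; apply Hub; exists (exp (Rabs r)); intros n.
    rewrite Rabs_mult, <- RPow_abs.
    apply Rle_trans with (2 := pow_div_fact_le_exp _ n (Rabs_pos r)).
    unfold Rdiv; rewrite Rmult_comm.
    apply Rmult_le_compat_l; [apply pow_le, Rabs_pos | apply Ha]. }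
  destruct (CV_radius a) as [l| |]; [|easy|].
  - specialize (Hr (l + 1)); simpl in Hr; lra.
  - specialize (Hr 0); easy.
Qed.

Definition J0_coeff (k : nat) : R := (-1) ^ k / INR (fact k) ^ 2.
Definition Y0_coeff (k : nat) : R := (-1) ^ k * harmonic k / INR (fact k) ^ 2.

Lemma fact_S_R (k : nat) : INR (fact (S k)) = (INR k + 1) * INR (fact k).
Proof. now rewrite fact_simpl, mult_INR, S_INR. Qed.

Lemma harmonic_S (k : nat) : harmonic (S k) = harmonic k + / (INR k + 1).
Proof.
  unfold harmonic; rewrite sum_n_Sm by lia.
  now rewrite S_INR.
Qed.

Lemma harmonic_0 : harmonic 0 = 0.
Proof. unfold harmonic; now rewrite sum_n_m_zero by lia. Qed.

Lemma harmonic_bounds (k : nat) : 0 <= harmonic k <= INR k.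
Proof.
  induction k as [|k IH].
  - rewrite harmonic_0; simpl; lra.
  - rewrite harmonic_S, S_INR.
    assert (Hk := pos_INR k).
    assert (0 < / (INR k + 1) <= 1).
    { split; [apply Rinv_0_lt_compat; lra|].
      rewrite <- Rinv_1; apply Rinv_le_contravar; lra. }
    lra.
Qed.

Lemma INR_le_fact (k : nat) : INR k <= INR (fact k).
Proof.
  apply le_INR; induction k as [|k IH]; [simpl; lia|].
  rewrite fact_simpl; assert (H := lt_O_fact k); nia.
Qed.

Lemma CV_radius_J0 : CV_radius J0_coeff = p_infty.
Proof.
  apply CV_radius_fact_bound; intros k; unfold J0_coeff.
  assert (Hf : 1 <= INR (fact k)).
  { apply (le_INR 1), lt_O_fact. }
  unfold Rdiv; rewrite Rabs_mult, pow_1_abs, Rmult_1_l.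
  rewrite Rabs_pos_eq by (left; apply Rinv_0_lt_compat; nra).
  apply Rinv_le_contravar; nra.
Qed.

Lemma CV_radius_Y0 : CV_radius Y0_coeff = p_infty.
Proof.
  apply CV_radius_fact_bound; intros k; unfold Y0_coeff.
  assert (Hf : 1 <= INR (fact k)).
  { apply (le_INR 1), lt_O_fact. }
  assert (Hh := harmonic_bounds k). assert (Hkf := INR_le_fact k).
  unfold Rdiv; rewrite !Rabs_mult, pow_1_abs, Rmult_1_l.
  rewrite (Rabs_pos_eq (harmonic k)) by lra.
  rewrite Rabs_pos_eq by (left; apply Rinv_0_lt_compat; nra).
  apply Rmult_le_reg_r with (INR (fact k) ^ 2); [nra|].
  field_simplify; lra.
Qed.

Lemma is_derive_PSeries_entire (a : nat -> R) (x : R) :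
  CV_radius a = p_infty -> is_derive (PSeries a) x (PSeries (PS_derive a) x).
Proof. intros H; apply is_derive_PSeries; now rewrite H. Qed.

Lemma CV_radius_derive_entire (a : nat -> R) :
  CV_radius a = p_infty -> CV_radius (PS_derive a) = p_infty.
Proof. now rewrite CV_radius_derive. Qed.

Lemma ex_pseries_entire (a : nat -> R) (x : R) :
  CV_radius a = p_infty -> ex_pseries a x.
Proof. intros H; apply CV_radius_inside; now rewrite H. Qed.

(** In the variable [z = x^2/4], the operator [u'' + u'/x + u] becomes [z f'' + f' + f], whose
    coefficient of [z^k] is [(k+1) k a_(k+1) + (k+1) a_(k+1) + a_k]. The right-hand side [c] is
    there for the series in [bessel_Y0], which is not itself a solution. *)
Lemma PSeries_bessel_operator (a c : nat -> R) (z : R) :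
  CV_radius a = p_infty ->
  (forall k, (INR k + 1) ^ 2 * a (S k) + a k = c k) ->
  z * PSeries (PS_derive (PS_derive a)) z + PSeries (PS_derive a) z + PSeries a z
    = PSeries c z.
Proof.
  intros Ha Hc.
  assert (H1 := CV_radius_derive_entire _ Ha).
  assert (H2 := CV_radius_derive_entire _ H1).
  rewrite <- PSeries_incr_1, <- !PSeries_plus.
  - apply PSeries_ext; intros k; rewrite <- Hc.
    unfold PS_plus, PS_incr_1, PS_derive; destruct k as [|k];
      rewrite ?S_INR; simpl; unfold plus, zero; simpl; ring.
  - apply ex_pseries_plus; [apply ex_pseries_incr_1|]; now apply ex_pseries_entire.
  - now apply ex_pseries_entire.
  - apply ex_pseries_incr_1; now apply ex_pseries_entire.
  - now apply ex_pseries_entire.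
Qed.

(** All that the later sections use of [bessel_J0] and [bessel_Y0]; the bounds at infinity are
    derived from it as well. *)
Definition bessel_solution (u u' : R -> R) : Prop :=
  forall x, 0 < x ->
    is_derive u x (u' x) /\ is_derive u' x (- u' x / x - u x).

Lemma is_derive_PSeries_quarter_square (a : nat -> R) (x : R) :
  CV_radius a = p_infty ->
  is_derive (fun t => PSeries a ((t / 2) ^ 2)) x
    (x / 2 * PSeries (PS_derive a) ((x / 2) ^ 2)).
Proof.
  intros Ha.
  apply (is_derive_comp (PSeries a) (fun t => (t / 2) ^ 2)).
  - now apply is_derive_PSeries_entire.
  - auto_derive; [easy|]. field.
Qed.

Definition J0' (x : R) : R := x / 2 * PSeries (PS_derive J0_coeff) ((x / 2) ^ 2).

Lemma is_derive_J0 (x : R) : is_derive bessel_J0 x (J0' x).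
Proof. apply is_derive_PSeries_quarter_square, CV_radius_J0. Qed.

Lemma is_derive_half_mult_PSeries (a : nat -> R) (x : R) :
  CV_radius a = p_infty ->
  is_derive (fun t => t / 2 * PSeries (PS_derive a) ((t / 2) ^ 2)) x
    (/ 2 * PSeries (PS_derive a) ((x / 2) ^ 2)
     + (x / 2) ^ 2 * PSeries (PS_derive (PS_derive a)) ((x / 2) ^ 2)).
Proof.
  intros Ha.
  assert (H := is_derive_PSeries_quarter_square _ x (CV_radius_derive_entire _ Ha)).
  evar_last.
  - apply (is_derive_mult (fun t => t / 2)); [|exact H|intros; apply Rmult_comm].
    auto_derive; [easy|reflexivity].
  - unfold plus, mult; simpl; field.
Qed.

Lemma bessel_solution_J0 : bessel_solution bessel_J0 J0'.
Proof.
  intros x Hx; split; [apply is_derive_J0|].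
  evar_last; [apply is_derive_half_mult_PSeries, CV_radius_J0|].
  assert (H : (x / 2) ^ 2 * PSeries (PS_derive (PS_derive J0_coeff)) ((x / 2) ^ 2)
              + PSeries (PS_derive J0_coeff) ((x / 2) ^ 2)
              + PSeries J0_coeff ((x / 2) ^ 2) = 0).
  { rewrite (PSeries_bessel_operator _ (fun _ => 0)).
    - apply PSeries_const_0.
    - exact CV_radius_J0.
    - intros k; unfold J0_coeff; rewrite fact_S_R; simpl.
      assert (Hk := pos_INR k). assert (Hf := INR_fact_lt_0 k).
      field; lra. }
  unfold J0', bessel_J0; fold J0_coeff.
  change (PSeries (fun k => (-1) ^ k / INR (fact k) ^ 2)) with (PSeries J0_coeff).
  replace (- (x / 2 * PSeries (PS_derive J0_coeff) ((x / 2) ^ 2)) / x)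
    with (- (/ 2 * PSeries (PS_derive J0_coeff) ((x / 2) ^ 2))) by (field; lra).
  lra.
Qed.

Definition Y0' (x : R) : R :=
  2 / PI * (/ x * bessel_J0 x + (ln (x / 2) + euler_gamma) * J0' x
            - x / 2 * PSeries (PS_derive Y0_coeff) ((x / 2) ^ 2)).

(** The operator maps [ln (x/2) J0] to [2 J0' / x], and the increments [1/(k+1)] of the harmonic
    numbers make the second series produce the same function. *)
Lemma bessel_solution_Y0 : bessel_solution bessel_Y0 Y0'.
Proof.
  intros x Hx.
  assert (Hln : is_derive (fun t => ln (t / 2) + euler_gamma) x (/ x)).
  { auto_derive; [lra|]; field; lra. }
  destruct (bessel_solution_J0 x Hx) as [HJ HJ'].
  assert (HP := PI_RGT_0).
  split.
  - unfold bessel_Y0, Y0'.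
    apply (is_derive_ext (fun t => 2 / PI *
      ((ln (t / 2) + euler_gamma) * bessel_J0 t - PSeries Y0_coeff ((t / 2) ^ 2)))).
    { intros t.
      change (PSeries (fun k => (-1) ^ k * harmonic k / INR (fact k) ^ 2))
        with (PSeries Y0_coeff).
      match goal with |- ?l = ?r => change (l = r :> R) end; ring. }
    apply is_derive_scal.
    apply @is_derive_minus.
    + evar_last; [apply (is_derive_mult _ _ _ _ _ Hln HJ); intros; apply Rmult_comm|].
      reflexivity.
    + apply is_derive_PSeries_quarter_square, CV_radius_Y0.
  - unfold Y0' at 1.
    evar_last.
    + apply is_derive_scal, @is_derive_minus; [apply @is_derive_plus|].
      * apply (is_derive_mult Rinv bessel_J0 x (- / x ^ 2)); [|exact HJ|intros; apply Rmult_comm].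
        auto_derive; [lra|]; field; lra.
      * apply (is_derive_mult _ _ _ _ _ Hln HJ'); intros; apply Rmult_comm.
      * apply is_derive_half_mult_PSeries, CV_radius_Y0.
    (* The two factors -1 cancel: the right-hand side is the derivative series of [J0_coeff], that
       is [2 J0' / x]. *)
    + assert (H := PSeries_bessel_operator Y0_coeff (PS_scal (-1) (PS_derive (PS_scal (-1) J0_coeff))) ((x / 2) ^ 2) CV_radius_Y0).
      rewrite PSeries_scal in H.
      rewrite (PSeries_ext (PS_derive (PS_scal (-1) J0_coeff)) (PS_scal (-1) (PS_derive J0_coeff))) in H.
      2:{ intros k; unfold PS_derive, PS_scal, scal; simpl; unfold mult; simpl; ring. }
      rewrite PSeries_scal in H.
      unfold plus, minus, opp, mult; simpl.
      unfold Y0', bessel_Y0.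
      change (PSeries (fun k => (-1) ^ k * harmonic k / INR (fact k) ^ 2))
        with (PSeries Y0_coeff).
      assert (HJx : J0' x = x / 2 * PSeries (PS_derive J0_coeff) ((x / 2) ^ 2)) by reflexivity.
      simpl in *.
      set (P1 := PSeries (PS_derive Y0_coeff) _) in *.
      set (P0 := PSeries Y0_coeff _) in *.
      set (P2 := PSeries (PS_derive (PS_derive Y0_coeff)) _) in *.
      set (Q := PSeries (PS_derive J0_coeff) _) in *.
      assert (HH : x / 2 * (x / 2 * 1) * P2 + P1 + P0 = Q).
      { rewrite H; [ring|].
        intros k; unfold PS_scal, PS_derive, scal; simpl; unfold mult; simpl.
        unfold Y0_coeff, J0_coeff; rewrite harmonic_S, fact_S_R.
        assert (Hk := pos_INR k). assert (Hf := INR_fact_lt_0 k).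
        change (match k with 0%nat => 1 | S _ => INR k + 1 end) with (INR (S k)).
        rewrite S_INR. simpl. field; lra. }
      replace P0 with (Q - x / 2 * (x / 2 * 1) * P2 - P1) by lra.
      rewrite HJx.
      match goal with |- context [plus ?a ?b] => change (plus a b) with (a + b) end.
      field; lra.
Qed.

(** * The shifted Bessel functions *)

Lemma le_of_derive_nonpos (f df : R -> R) (a x : R) :
  (forall t, a <= t -> is_derive f t (df t)) ->
  (forall t, a <= t -> df t <= 0) -> a <= x -> f x <= f a.
Proof.
  intros Hd Hn Hx.
  destruct (MVT_gen f a x df) as [c [Hc Heq]].
  - intros t; rewrite Rmin_left by easy; intros [Ht _]; apply Hd; lra.
  - intros t; rewrite Rmin_left by easy; intros [Ht _].
    apply continuity_pt_filterlim, (ex_derive_continuous f); exists (df t); now apply Hd.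
  - rewrite Rmin_left in Hc by easy.
    assert (df c <= 0) by (apply Hn; lra). nra.
Qed.

Lemma Rabs_le_sqrt (x E : R) : x ^ 2 <= E -> Rabs x <= sqrt E.
Proof.
  intros H; rewrite <- (sqrt_pow2 (Rabs x)) by apply Rabs_pos.
  apply sqrt_le_1_alt; now rewrite pow2_abs.
Qed.

(** The term [- u'/x] is a damping, so [u^2 + u'^2] has derivative [- 2 u'^2 / x <= 0]. Starting at
    [x0 > 0] avoids the singularity of [Y0] at the origin. *)
Lemma bessel_solution_bounded (u u' : R -> R) (x0 : R) :
  bessel_solution u u' -> 0 < x0 ->
  exists U, 0 < U /\ forall x, x0 <= x -> Rabs (u x) <= U /\ Rabs (u' x) <= U.
Proof.
  intros Hu H0.
  set (E := fun x => u x ^ 2 + u' x ^ 2).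
  (* The added 1 keeps the bound positive even for the zero solution. *)
  exists (sqrt (E x0) + 1); split; [assert (H := sqrt_pos (E x0)); lra|].
  intros x Hx.
  assert (HE : E x <= E x0).
  { apply le_of_derive_nonpos with (df := fun t => - 2 * u' t ^ 2 / t); [| |easy].
    - intros t Ht; destruct (Hu t) as [H1 H2]; [lra|].

      unfold E; auto_derive; [split; [eexists; exact H1|split; [eexists; exact H2|easy]]|].
      apply is_derive_unique in H1, H2.
      rewrite (H1 : Derive (fun x : R => u x) t = _), (H2 : Derive (fun x : R => u' x) t = _).
      field; lra.
    - intros t Ht; assert (0 < / t) by (apply Rinv_0_lt_compat; lra).
      unfold Rdiv; assert (0 <= u' t ^ 2) by apply pow2_ge_0; nra. }
  assert (Hs : sqrt (E x) <= sqrt (E x0)) by now apply sqrt_le_1_alt.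
  assert (H1 := pow2_ge_0 (u x)). assert (H2 := pow2_ge_0 (u' x)).
  split; apply Rle_trans with (sqrt (E x)); try lra;
    apply Rabs_le_sqrt; unfold E; lra.
Qed.

(** Lengths are in grid units: [d] is the horizontal offset of the two points and [s] the square of
    the vertical one. *)
Definition shifted (u : R -> R) (kappa s d : R) : R := u (kappa * sqrt (d ^ 2 + s)).

Definition shifted' (u' : R -> R) (kappa s d : R) : R :=
  kappa * d * u' (kappa * sqrt (d ^ 2 + s)) / sqrt (d ^ 2 + s).

(** With [r = sqrt (d^2 + s)] one has [r' = d/r], and after elimination of [u''] only [r^2]
    survives. Cleared of denominators the equation is [d (d^2 + s) F'' + (d^2 - s) F' + kappa^2 d^3
    F = 0], the form in which residuals are measured below. *)
Lemma shifted_ode (u u' : R -> R) (kappa s d : R) :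
  bessel_solution u u' -> 0 < kappa -> 0 <= s -> 0 < d ->
  is_derive (shifted u kappa s) d (shifted' u' kappa s d) /\
  is_derive (shifted' u' kappa s) d
    (- ((d ^ 2 - s) * shifted' u' kappa s d + kappa ^ 2 * d ^ 3 * shifted u kappa s d)
     / (d * (d ^ 2 + s))).
Proof.
  intros Hu Hk Hs Hd.
  assert (Hq : 0 < d ^ 2 + s) by nra.
  assert (Hr := sqrt_lt_R0 _ Hq).
  assert (Hrr := pow2_sqrt _ (Rlt_le _ _ Hq)).
  assert (Hkr : 0 < kappa * sqrt (d ^ 2 + s)) by nra.
  destruct (Hu _ Hkr) as [H1 H2].
  split; unfold shifted, shifted'; auto_derive;
    replace (d * (d * 1) + s) with (d ^ 2 + s) by ring.
  - split; [eexists; exact H1 | easy].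
  - apply is_derive_unique in H1.
    rewrite (H1 : Derive (fun x : R => u x) _ = _); field; lra.
  - repeat split; try (eexists; exact H2); trivial; lra.
  - apply is_derive_unique in H2.
    rewrite (H2 : Derive (fun x : R => u' x) _ = _).
    set (r := sqrt (d ^ 2 + s)) in *.
    replace s with (r ^ 2 - d ^ 2) by lra.
    set (a := u (kappa * r)). set (b := u' (kappa * r)).
    field; repeat split; try lra; nra.
Qed.

(** This is [d^(-k-1/2)], written with [sqrt] and a natural power so that identities stay within
    reach of [field]. *)
Definition hpow (k : nat) (d : R) : R := / (sqrt d * d ^ k).

Lemma hpow_pos (k : nat) (d : R) : 0 < d -> 0 < hpow k d.
Proof.
  intros Hd; apply Rinv_0_lt_compat, Rmult_lt_0_compat;
    [now apply sqrt_lt_R0 | now apply pow_lt].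
Qed.

Lemma hpow_S (k : nat) (d : R) : 0 < d -> hpow (S k) d = hpow k d / d.
Proof.
  intros Hd; unfold hpow; assert (H := sqrt_lt_R0 _ Hd); assert (H' := pow_lt _ k Hd).
  simpl; field; lra.
Qed.

Lemma hpow_antitone (k : nat) (c d : R) : 0 < c <= d -> hpow k d <= hpow k c.
Proof.
  intros [Hc Hd]; apply Rinv_le_contravar.
  - apply Rmult_lt_0_compat; [now apply sqrt_lt_R0 | now apply pow_lt].
  - apply Rmult_le_compat; [apply sqrt_pos | apply pow_le; lra | |].
    + now apply sqrt_le_1_alt.
    + apply pow_incr; lra.
Qed.

Lemma is_derive_hpow (k : nat) (d : R) :
  0 < d -> is_derive (hpow k) d (- (INR k + / 2) * hpow (S k) d).
Proof.
  intros Hd; unfold hpow; assert (H := sqrt_lt_R0 _ Hd); assert (H' := pow_lt _ k Hd).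
  assert (Hs := pow2_sqrt _ (Rlt_le _ _ Hd)).
  auto_derive.
  - repeat split; [lra | apply Rgt_not_eq; now apply Rmult_lt_0_compat].
  - destruct k as [|k].
    + simpl; set (q := sqrt d) in *. replace d with (q * q) by (simpl in Hs; lra).
      field; lra.
    + assert (Hk := pow_lt _ k Hd).
      rewrite S_INR; simpl Nat.pred.
      simpl pow. set (q := sqrt d) in *. set (w := d ^ k) in *.
      replace d with (q * q) by (simpl in Hs; lra).
      change (match k with 0%nat => 1 | S _ => INR k + 1 end) with (INR (S k)).
      rewrite ?S_INR.
      field; lra.
Qed.

(** * Formal asymptotic solutions *)

(* Third-order recurrence for [c_k], carried as the triple [(c_k, c_(k-1), c_(k-2))] with
   [c_(-1) = c_(-2) = 0]; it cancels the coefficient of [d^(1/2-k)] in the ODE satisfied by [shifted]. *)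
Fixpoint acoeff3 (kappa s : R) (k : nat) : R * R * R :=
  match k with
  | O => (1, 0, 0)
  | S k =>
      let '(x, y, z) := acoeff3 kappa s k in
      ((((INR k + / 2) ^ 2 - kappa ^ 2 * s) * x + 2 * INR k * kappa * s * y
        - s * (INR k - 3 / 2) * (INR k + / 2) * z) / (2 * kappa * (INR k + 1)), x, y)
  end.

Definition acoeff (kappa s : R) (k : nat) : R := fst (fst (acoeff3 kappa s k)).
Definition acoeff_prev (kappa s : R) (k : nat) : R := snd (fst (acoeff3 kappa s k)).
Definition acoeff_prev2 (kappa s : R) (k : nat) : R := snd (acoeff3 kappa s k).

Lemma acoeff_S (kappa s : R) (k : nat) :
  acoeff kappa s (S k) =
    (((INR k + / 2) ^ 2 - kappa ^ 2 * s) * acoeff kappa s k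
     + 2 * INR k * kappa * s * acoeff_prev kappa s k
     - s * (INR k - 3 / 2) * (INR k + / 2) * acoeff_prev2 kappa s k)
    / (2 * kappa * (INR k + 1)).
Proof.
  unfold acoeff, acoeff_prev, acoeff_prev2; simpl.
  now destruct (acoeff3 kappa s k) as [[x y] z].
Qed.

Lemma acoeff_prev_S (kappa s : R) (k : nat) :
  acoeff_prev kappa s (S k) = acoeff kappa s k.
Proof.
  unfold acoeff, acoeff_prev; simpl.
  now destruct (acoeff3 kappa s k) as [[x y] z].
Qed.

Lemma acoeff_prev2_S (kappa s : R) (k : nat) :
  acoeff_prev2 kappa s (S k) = acoeff_prev kappa s k.
Proof.
  unfold acoeff_prev, acoeff_prev2; simpl.
  now destruct (acoeff3 kappa s k) as [[x y] z].
Qed.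

(* Gevrey-1 growth of the coefficients of the (divergent) expansion. *)
Definition gev (B : R) (k : nat) : R := B ^ k * INR (fact k).

Lemma gev_pos (B : R) (k : nat) : 0 < B -> 0 < gev B k.
Proof.
  intros HB; apply Rmult_lt_0_compat; [now apply pow_lt | apply INR_fact_lt_0].
Qed.

Lemma gev_S (B : R) (k : nat) : gev B (S k) = B * (INR k + 1) * gev B k.
Proof. unfold gev; rewrite fact_S_R; simpl; ring. Qed.

(** The previous coefficients enter the recurrence with weights of size [k] and [k^2], so they are
    bounded together with those weights; each shift of the index gains one factor of the factorial.
    The numerator is then at most the left side of the last hypothesis times [(k+1)^2 gev B k], and
    dividing by [2 kappa (k+1)] gives [gev B (S k)]. The weight [k |k - 1|] says nothing for
    [k <= 1], where [(k - 3/2)(k + 1/2)] does not vanish; hence the last conjunct. *)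
Lemma acoeff_bound (kappa s B : R) (k : nat) :
  0 < kappa -> 0 <= s -> 1 <= B ->
  1 + kappa ^ 2 * s + 2 * kappa * s + 2 * s <= 2 * kappa * B ->
  Rabs (acoeff kappa s k) <= gev B k /\
  INR k * Rabs (acoeff_prev kappa s k) <= gev B k /\
  INR k * Rabs (INR k - 1) * Rabs (acoeff_prev2 kappa s k) <= gev B k /\
  ((k <= 1)%nat -> acoeff_prev2 kappa s k = 0).
Proof.
  intros Hk Hs HB HC.
  induction k as [|k (I1 & I2 & I3 & I4)].
  - unfold acoeff, acoeff_prev, acoeff_prev2, gev; simpl.
    rewrite Rabs_R1; repeat split; lra.
  - assert (Hg : 0 < gev B k) by (apply gev_pos; lra).
    assert (Hik := pos_INR k).
    assert (Hle : (INR k + 1) * gev B k <= gev B (S k)).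
    { rewrite gev_S; assert (0 <= (B - 1) * ((INR k + 1) * gev B k)); [|lra].
      apply Rmult_le_pos; [lra|apply Rmult_le_pos; lra]. }
    rewrite acoeff_prev_S, acoeff_prev2_S.
    repeat split.
    + rewrite acoeff_S.
      unfold Rdiv at 1; rewrite Rabs_mult.
      rewrite (Rabs_pos_eq (/ _)) by (left; apply Rinv_0_lt_compat; nra).
      apply Rmult_le_reg_r with (2 * kappa * (INR k + 1)); [nra|].
      rewrite Rmult_assoc, Rinv_l, Rmult_1_r by nra.
      apply Rle_trans with
        ((1 + kappa ^ 2 * s + 2 * kappa * s + 2 * s) * ((INR k + 1) ^ 2 * gev B k)).
      2:{ rewrite gev_S.
          replace (B * (INR k + 1) * gev B k * (2 * kappa * (INR k + 1)))
            with (2 * kappa * B * ((INR k + 1) ^ 2 * gev B k)) by ring.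
          apply Rmult_le_compat_r; [|easy].
          apply Rmult_le_pos; [apply pow2_ge_0|lra]. }
      assert (Hz : Rabs ((INR k - 3 / 2) * (INR k + / 2) * acoeff_prev2 kappa s k)
                   <= 2 * gev B k).
      { destruct (le_lt_dec k 1) as [H1|H1].
        - rewrite I4 by easy; rewrite Rmult_0_r, Rabs_R0; lra.
        - apply (le_INR 2) in H1; simpl in H1.
          rewrite Rabs_mult.
          rewrite (Rabs_pos_eq (_ * _)) by nra.
          rewrite (Rabs_pos_eq (_ - 1)) in I3 by lra.
          apply Rle_trans with (2 * (INR k * (INR k - 1) * Rabs (acoeff_prev2 kappa s k)));
            [|lra].
          rewrite <- !Rmult_assoc.
          apply Rmult_le_compat_r; [apply Rabs_pos|nra]. }
      assert (Hx : Rabs (((INR k + / 2) ^ 2 - kappa ^ 2 * s) * acoeff kappa s k)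
                   <= (1 + kappa ^ 2 * s) * ((INR k + 1) ^ 2 * gev B k)).
      { rewrite Rabs_mult, <- Rmult_assoc.
        apply Rmult_le_compat; try apply Rabs_pos; [|easy].
        assert (0 <= kappa ^ 2 * s) by (apply Rmult_le_pos; [apply pow2_ge_0|lra]).
        apply Rabs_le; split; nra. }
      assert (Hy : Rabs (2 * INR k * kappa * s * acoeff_prev kappa s k)
                   <= 2 * kappa * s * gev B k).
      { replace (2 * INR k * kappa * s * acoeff_prev kappa s k)
          with ((2 * kappa * s) * (INR k * acoeff_prev kappa s k)) by ring.
        rewrite (Rabs_mult (2 * kappa * s)), (Rabs_mult (INR k)), (Rabs_pos_eq (INR k)) by easy.
        assert (0 <= kappa * s) by nra.
        rewrite (Rabs_pos_eq (2 * kappa * s)) by nra.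
        apply Rmult_le_compat_l; [lra|easy]. }
      assert (H2k : gev B k <= (INR k + 1) ^ 2 * gev B k).
      { rewrite <- (Rmult_1_l (gev B k)) at 1; apply Rmult_le_compat_r; [lra|nra]. }
      assert (0 <= kappa * s) by nra.
      eapply Rle_trans; [apply Rabs_triang|]; rewrite Rabs_Ropp.
      eapply Rle_trans; [apply Rplus_le_compat_r, Rabs_triang|].
      replace (s * (INR k - 3 / 2) * (INR k + / 2) * acoeff_prev2 kappa s k)
        with (s * ((INR k - 3 / 2) * (INR k + / 2) * acoeff_prev2 kappa s k)) by ring.
      rewrite (Rabs_mult s), (Rabs_pos_eq s) by easy.
      assert (s * Rabs ((INR k - 3 / 2) * (INR k + / 2) * acoeff_prev2 kappa s k)
              <= s * (2 * ((INR k + 1) ^ 2 * gev B k))).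
      { apply Rmult_le_compat_l; lra. }
      assert (2 * kappa * s * gev B k <= 2 * kappa * s * ((INR k + 1) ^ 2 * gev B k)).
      { apply Rmult_le_compat_l; lra. }
      lra.
    + rewrite S_INR; apply Rle_trans with (2 := Hle).
      apply Rmult_le_compat_l; lra.
    + rewrite S_INR; apply Rle_trans with (2 := Hle).
      replace (INR k + 1 - 1) with (INR k) by ring.
      rewrite (Rabs_pos_eq (INR k)) by easy.
      rewrite Rmult_assoc; apply Rmult_le_compat_l; lra.
    + intros Hk1; assert (k = 0)%nat as -> by lia. reflexivity.
Qed.

(** The real part of [exp (i (kappa d + phi)) (-i)^k]: a quarter turn per order lets one real
    coefficient sequence serve every phase [phi]. *)
Definition cphase (kappa phi : R) (k : nat) (d : R) : R :=
  cos (kappa * d + phi - INR k * (PI / 2)).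
Definition sphase (kappa phi : R) (k : nat) (d : R) : R :=
  sin (kappa * d + phi - INR k * (PI / 2)).

Lemma cphase_S (kappa phi : R) (k : nat) (d : R) :
  cphase kappa phi (S k) d = sphase kappa phi k d.
Proof.
  unfold cphase, sphase; rewrite S_INR, <- cos_shift.
  rewrite <- cos_neg; f_equal; ring.
Qed.

Lemma sphase_S (kappa phi : R) (k : nat) (d : R) :
  sphase kappa phi (S k) d = - cphase kappa phi k d.
Proof.
  unfold cphase, sphase; rewrite S_INR, <- sin_shift.
  rewrite <- sin_neg; f_equal; ring.
Qed.

Definition wterm (kappa phi : R) (k : nat) (d : R) : R :=
  hpow k d * cphase kappa phi k d.
Definition wterm' (kappa phi : R) (k : nat) (d : R) : R :=
  - (INR k + / 2) * hpow (S k) d * cphase kappa phi k d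
  - kappa * hpow k d * sphase kappa phi k d.
Definition wterm'' (kappa phi : R) (k : nat) (d : R) : R :=
  (INR k + / 2) * (INR k + 3 / 2) * hpow (S (S k)) d * cphase kappa phi k d
  + 2 * (INR k + / 2) * kappa * hpow (S k) d * sphase kappa phi k d
  - kappa ^ 2 * hpow k d * cphase kappa phi k d.

Lemma is_derive_cphase (kappa phi : R) (k : nat) (d : R) :
  is_derive (cphase kappa phi k) d (- kappa * sphase kappa phi k d).
Proof. unfold cphase, sphase; auto_derive; [easy|]; unfold Rminus; ring. Qed.

Lemma is_derive_sphase (kappa phi : R) (k : nat) (d : R) :
  is_derive (sphase kappa phi k) d (kappa * cphase kappa phi k d).
Proof. unfold cphase, sphase; auto_derive; [easy|]; unfold Rminus; ring. Qed.

Lemma is_derive_wterm (kappa phi : R) (k : nat) (d : R) :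
  0 < d -> is_derive (wterm kappa phi k) d (wterm' kappa phi k d).
Proof.
  intros Hd; unfold wterm, wterm'.
  evar_last.
  - apply (is_derive_mult (hpow k) (cphase kappa phi k));
      [now apply is_derive_hpow | apply is_derive_cphase | intros; apply Rmult_comm].
  - unfold plus, mult; simpl; ring.
Qed.

Lemma is_derive_wterm' (kappa phi : R) (k : nat) (d : R) :
  0 < d -> is_derive (wterm' kappa phi k) d (wterm'' kappa phi k d).
Proof.
  intros Hd; unfold wterm', wterm''.
  assert (H1 : is_derive (fun t => - (INR k + / 2) * hpow (S k) t) d
                 ((INR k + / 2) * (INR k + 3 / 2) * hpow (S (S k)) d)).
  { evar_last; [apply is_derive_scal, is_derive_hpow, Hd|].
    rewrite S_INR; match goal with |- ?l = ?r => change (l = r :> R) end; field. }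
  assert (H2 : is_derive (fun t => kappa * hpow k t) d
                 (kappa * (- (INR k + / 2) * hpow (S k) d))).
  { apply is_derive_scal, is_derive_hpow, Hd. }
  evar_last.
  - apply @is_derive_minus.
    + apply (is_derive_mult _ _ _ _ _ H1 (is_derive_cphase kappa phi k d)).
      intros; apply Rmult_comm.
    + apply (is_derive_mult _ _ _ _ _ H2 (is_derive_sphase kappa phi k d)).
      intros; apply Rmult_comm.
  - unfold minus, plus, opp, mult; simpl; unfold plus; simpl; ring.
Qed.

(** With the summand as a parameter, the truncated expansion and its first two derivatives are
    instances of one sum. *)
Definition wave (f : R -> R -> nat -> R -> R) (kappa s phi : R) (N : nat) (d : R) : R :=
  sum_f_R0 (fun k => acoeff kappa s k * f kappa phi k d) N.

Lemma is_derive_wave (f f' : R -> R -> nat -> R -> R) (kappa s phi : R) (N : nat) (d : R) :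
  (forall k, is_derive (f kappa phi k) d (f' kappa phi k d)) ->
  is_derive (wave f kappa s phi N) d (wave f' kappa s phi N d).
Proof.
  intros H; unfold wave; induction N as [|N IH]; simpl.
  - now apply is_derive_scal.
  - apply @is_derive_plus; [exact IH|now apply is_derive_scal].
Qed.

(* By the recurrence everything telescopes except the orders beyond [N]. *)
Lemma wave_residual (kappa s phi : R) (N : nat) (d : R) :
  0 < kappa -> 0 < d ->
  d * (d ^ 2 + s) * wave wterm'' kappa s phi N d
  + (d ^ 2 - s) * wave wterm' kappa s phi N d
  + kappa ^ 2 * d ^ 3 * wave wterm kappa s phi N d
  = hpow N d *
    ((2 * kappa * (INR N + 1) * acoeff kappa s (S N) * d
      + s * (INR N + / 2) * (INR N + 5 / 2) * acoeff kappa s N / d) * cphase kappa phi N d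
     + (2 * kappa * s * (INR N + 1) * acoeff kappa s N
        - s * (INR N - / 2) * (INR N + 3 / 2) * acoeff_prev kappa s N)
       * sphase kappa phi N d).
Proof.
  intros Hk Hd; unfold wave; induction N as [|N IH].
  - rewrite acoeff_S; unfold acoeff, acoeff_prev, acoeff_prev2; simpl.
    unfold wterm, wterm', wterm''; rewrite !hpow_S by easy; simpl.
    field; lra.
  - rewrite !tech5.
    match goal with
    |- ?p * (?a1 + ?a2) + ?q * (?b1 + ?b2) + ?r * (?c1 + ?c2) = _ =>
      transitivity ((p * a1 + q * b1 + r * c1) + (p * a2 + q * b2 + r * c2)); [ring|]
    end.
    rewrite IH; clear IH.
    (* Eliminating [c_(N+2)] leaves an identity that is linear in [c_(N+1)], [c_N], [c_(N-1)] and in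
       the two phases of order [N]. *)
    rewrite (acoeff_S _ _ (S N)), acoeff_prev_S, acoeff_prev2_S.
    unfold wterm, wterm', wterm''; rewrite !hpow_S, !cphase_S, !sphase_S by easy.
    rewrite !S_INR.
    assert (Hn := pos_INR N).
    field; lra.
Qed.

(** * Error estimates *)

Lemma exp_monotone (x y : R) : x <= y -> exp x <= exp y.
Proof. intros [H | ->]; [left; now apply exp_increasing | lra]. Qed.

(* With [E = e'^2 + kappa^2 e^2] one gets [E' <= K (E + phi^2) / d^2], hence
   [(E + phi^2) exp (K / d)] is nonincreasing. *)
Lemma forced_ode_bound (kappa s D phi : R) (e e' g : R -> R) :
  0 < kappa -> 0 <= s <= D ^ 2 -> 1 <= D -> 0 <= phi ->
  (forall d, D <= d -> is_derive e d (e' d)) ->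
  (forall d, D <= d -> is_derive e' d
     ((g d - (d ^ 2 - s) * e' d - kappa ^ 2 * d ^ 3 * e d) / (d * (d ^ 2 + s)))) ->
  (forall d, D <= d -> Rabs (g d) <= phi * d) ->
  e D = 0 -> e' D = 0 ->
  forall d, D <= d -> Rabs (e d) <= phi * exp (kappa * s + 1) / kappa.
Proof.
  intros Hk Hs HD Hphi He He' Hg H0 H0' d Hd.
  set (K := kappa * s + 1).
  assert (HK : 1 <= K) by (unfold K; nra).
  set (H := fun t => (e' t ^ 2 + kappa ^ 2 * e t ^ 2 + phi ^ 2) * exp (K / t)).
  assert (HH : H d <= H D).
  { apply le_of_derive_nonpos with (df := fun t =>
      (2 * e' t * ((g t - (t ^ 2 - s) * e' t - kappa ^ 2 * t ^ 3 * e t) / (t * (t ^ 2 + s)))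
       + 2 * kappa ^ 2 * e t * e' t
       - K / t ^ 2 * (e' t ^ 2 + kappa ^ 2 * e t ^ 2 + phi ^ 2)) * exp (K / t)); [| |easy].
    - intros t Ht; specialize (He t Ht); specialize (He' t Ht).
      unfold H; auto_derive.
      + repeat split; try (eexists; first [exact He | exact He']); lra.
      + apply is_derive_unique in He, He'.
        rewrite (He : Derive (fun x : R => e x) t = _), (He' : Derive (fun x : R => e' x) t = _).
        unfold Rdiv; set (X := exp _). field; split; first [lra | nra].
    - intros t Ht; specialize (Hg t Ht).
      assert (Hexp := exp_pos (K / t)).
      assert (Ht2 : 0 < t ^ 2 + s) by nra.
      assert (Hts : s <= t ^ 2) by nra.
      set (E := e' t ^ 2 + kappa ^ 2 * e t ^ 2 + phi ^ 2).
      (* Young's inequality is applied to the forcing (weight 1) and to the cross term (weight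
         [kappa s]), which add up to [K]; the damping term has the good sign because [s <= t^2]. *)
      assert (Hcore : 2 * e' t * g t - 2 * (t ^ 2 - s) * e' t ^ 2
                      + 2 * kappa ^ 2 * s * t * e t * e' t <= t * (K * E)).
      { assert (2 * e' t * g t <= t * (e' t ^ 2 + phi ^ 2)).
        { apply Rle_trans with (2 * Rabs (e' t) * (phi * t)).
          - apply Rle_trans with (1 := Rle_abs _).
            rewrite !Rabs_mult, (Rabs_pos_eq 2) by lra.
            apply Rmult_le_compat_l; [|easy].
            assert (Ha := Rabs_pos (e' t)); lra.
          - rewrite <- (pow2_abs (e' t)).
            assert (0 <= t * (Rabs (e' t) - phi) ^ 2); [|nra].
            apply Rmult_le_pos; [lra|apply pow2_ge_0]. }
        assert (0 <= (t ^ 2 - s) * e' t ^ 2).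
        { apply Rmult_le_pos; [lra|apply pow2_ge_0]. }
        assert (Hm : 0 <= kappa * s * t) by (apply Rmult_le_pos; nra).
        assert (0 <= (kappa * s * t) * (kappa * e t - e' t) ^ 2).
        { apply Rmult_le_pos; [easy|apply pow2_ge_0]. }
        assert (0 <= t * (kappa ^ 2 * e t ^ 2)).
        { apply Rmult_le_pos; [lra|]; apply Rmult_le_pos; apply pow2_ge_0. }
        assert (0 <= (kappa * s * t) * phi ^ 2).
        { apply Rmult_le_pos; [easy|apply pow2_ge_0]. }
        unfold K, E; nra. }
      apply Rmult_le_0_r; [|lra].
      replace (2 * e' t * ((g t - (t ^ 2 - s) * e' t - kappa ^ 2 * t ^ 3 * e t) / (t * (t ^ 2 + s))) + 2 * kappa ^ 2 * e t * e' t)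
        with ((2 * e' t * g t - 2 * (t ^ 2 - s) * e' t ^ 2
                      + 2 * kappa ^ 2 * s * t * e t * e' t) / (t * (t ^ 2 + s)))
        by (field; split; first [lra | nra]).
      assert (HE : 0 <= K * E).
      { assert (0 <= E); [|nra]. unfold E.
        assert (0 <= kappa ^ 2 * e t ^ 2) by (apply Rmult_le_pos; apply pow2_ge_0).
        assert (A1 := pow2_ge_0 (e' t)). assert (A2 := pow2_ge_0 phi). lra. }
      apply Rle_minus.
      apply Rle_trans with (t * (K * E) / (t * (t ^ 2 + s))).
      + apply Rmult_le_compat_r; [|easy].
        left; apply Rinv_0_lt_compat; nra.
      + replace (t * (K * E) / (t * (t ^ 2 + s))) with (K * E / (t ^ 2 + s))
          by (field; split; first [lra | nra]).
        replace (K / t ^ 2 * E) with (K * E / t ^ 2) by (field; lra).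
        apply Rmult_le_compat_l; [easy|].
        apply Rinv_le_contravar; nra. }
  unfold H in HH; rewrite H0, H0' in HH.
  assert (Hed : 1 <= exp (K / d)).
  { rewrite <- exp_0; apply exp_monotone; apply Rle_div_r; lra. }
  assert (HeD : exp (K / D) <= exp K).
  { apply exp_monotone; apply Rle_div_l; nra. }
  assert (HeK : 1 <= exp K).
  { rewrite <- exp_0; apply exp_monotone; lra. }
  (* At [D] only [phi^2] is left of the energy, and [exp (K / D) <= exp K <= (exp K)^2]. *)
  assert (Hsq : kappa ^ 2 * e d ^ 2 <= (phi * exp K) ^ 2).
  { assert (A1 := pow2_ge_0 (e' d)). assert (A2 := pow2_ge_0 phi).
    assert (A3 : 0 <= kappa ^ 2 * e d ^ 2) by (apply Rmult_le_pos; apply pow2_ge_0).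
    apply Rle_trans with (phi ^ 2 * exp (K / D)); [nra|].
    rewrite Rpow_mult_distr; apply Rmult_le_compat_l; [easy|nra]. }
  apply Rle_div_r; [lra|].
  rewrite <- (Rabs_pos_eq kappa) by lra.
  rewrite <- Rabs_mult.
  apply Rsqr_incr_0_var; [|apply Rmult_le_pos; lra].
  rewrite !Rsqr_pow2, pow2_abs; fold K. lra.
Qed.

(** * The truncated expansion beyond the cutoff *)

Lemma fact_le_pow (k m : nat) : (k <= m)%nat -> INR (fact k) <= INR m ^ k.
Proof.
  induction k as [|k IH]; intros H; [simpl; lra|].
  rewrite fact_S_R; simpl pow.
  apply Rmult_le_compat; [assert (A := pos_INR k); lra | apply pos_INR | |apply IH; lia].
  rewrite <- S_INR; now apply le_INR.
Qed.

(** Up to order [N + 1] the factorial growth is no worse than geometric with ratio [B (N + 1)]; this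
    is why the cutoff is a multiple of that ratio. *)
Lemma gev_le_pow (B : R) (N k : nat) :
  0 <= B -> (k <= S N)%nat -> gev B k <= (B * (INR N + 1)) ^ k.
Proof.
  intros HB Hk; unfold gev; rewrite Rpow_mult_distr, <- S_INR.
  apply Rmult_le_compat_l; [now apply pow_le | now apply fact_le_pow].
Qed.

(** The last inequality is the one that closes the induction in [acoeff_bound]; it also yields
    [1 <= 2 kappa B], hence [kappa * cutoff B N >= 16 (N + 1)]. *)
Definition admissible (kappa s B : R) : Prop :=
  0 < kappa /\ 0 <= s <= 4 /\ 1 <= B /\
  1 + kappa ^ 2 * s + 2 * kappa * s + 2 * s <= 2 * kappa * B.

(* Beyond [cutoff B N] the first [N + 1] terms of the expansion decay like [32^(-k)]. *)
Definition cutoff (B : R) (N : nat) : R := 32 * B * (INR N + 1).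

Lemma cutoff_ge (B : R) (N : nat) : 1 <= B -> 32 <= cutoff B N.
Proof. intros HB; unfold cutoff; assert (H := pos_INR N); nra. Qed.

Lemma acoeff_decay (kappa s B : R) (N k : nat) (d : R) :
  admissible kappa s B -> (k <= S N)%nat -> cutoff B N <= d ->
  Rabs (acoeff kappa s k / d ^ k) <= / 32 ^ k.
Proof.
  intros (Hk & Hs & HB & HC) HkN Hd.
  assert (Hc := cutoff_ge B N HB).
  assert (Hdk : 0 < d ^ k) by (apply pow_lt; lra).
  assert (H32 : 0 < 32 ^ k) by (apply pow_lt; lra).
  unfold Rdiv; rewrite Rabs_mult, (Rabs_pos_eq (/ _)) by (left; now apply Rinv_0_lt_compat).
  apply Rle_div_l; [easy|].
  destruct (acoeff_bound kappa s B k) as [Hb _]; try easy.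
  apply Rle_trans with (1 := Hb).
  apply Rle_trans with (1 := gev_le_pow B N k ltac:(lra) HkN).
  apply Rmult_le_reg_l with (32 ^ k); [easy|].
  rewrite <- (Rmult_assoc (32 ^ k)), Rinv_r, Rmult_1_l, <- Rpow_mult_distr by lra.
  apply pow_incr; unfold cutoff in Hd; assert (A := pos_INR N); nra.
Qed.

Lemma sqrt_hpow (k : nat) (d : R) : 0 < d -> sqrt d * hpow k d = / d ^ k.
Proof.
  intros Hd; unfold hpow; assert (H := sqrt_lt_R0 _ Hd); assert (H' := pow_lt _ k Hd).
  field; lra.
Qed.

Lemma cphase_bound (kappa phi : R) (k : nat) (d : R) : Rabs (cphase kappa phi k d) <= 1.
Proof. apply Rabs_le, COS_bound. Qed.

Lemma sphase_bound (kappa phi : R) (k : nat) (d : R) : Rabs (sphase kappa phi k d) <= 1.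
Proof. apply Rabs_le, SIN_bound. Qed.

Lemma Rabs_mult_le (a b x y : R) : Rabs a <= x -> Rabs b <= y -> Rabs (a * b) <= x * y.
Proof. intros H1 H2; rewrite Rabs_mult; apply Rmult_le_compat; try apply Rabs_pos; easy. Qed.

(** The order-0 term is exactly the cosine, and the orders [k >= 1] contribute at most [32^(-k)]
    each. The induction carries the exact geometric partial sum, whose limit is 1/31. *)
Lemma wave_leading (kappa s B phi : R) (N : nat) (d : R) :
  admissible kappa s B -> cutoff B N <= d ->
  Rabs (sqrt d * wave wterm kappa s phi N d - cos (kappa * d + phi)) <= / 30.
Proof.
  intros HA Hd.
  assert (H0d : 0 < d).
  { destruct HA as (_ & _ & HB & _); assert (Hc := cutoff_ge B N HB); lra. }
  assert (Hn : forall n, (n <= N)%nat ->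
    Rabs (sqrt d * wave wterm kappa s phi n d - cos (kappa * d + phi)) <= / 31 * (1 - / 32 ^ n)).
  { induction n as [|n IH]; intros Hn.
    - unfold wave, wterm, acoeff, cphase; simpl.
      replace (kappa * d + phi - 0 * (PI / 2)) with (kappa * d + phi) by ring.
      replace (_ - _) with (cos (kappa * d + phi) * (sqrt d * hpow 0 d - 1)) by ring.
      rewrite sqrt_hpow by easy; simpl.
      replace (cos _ * _) with 0 by field; rewrite Rabs_R0; lra.
    - unfold wave in *; rewrite tech5.
      specialize (IH ltac:(lia)).
      set (S0 := sum_f_R0 _ _) in *.
      replace (_ - _) with ((sqrt d * S0 - cos (kappa * d + phi))
        + acoeff kappa s (S n) / d ^ S n * cphase kappa phi (S n) d).
      2:{ unfold wterm, Rdiv; rewrite <- sqrt_hpow by easy; ring. }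
      apply Rle_trans with (1 := Rabs_triang _ _).
      assert (Ht := Rabs_mult_le _ _ _ _
        (acoeff_decay kappa s B N (S n) d HA ltac:(lia) Hd) (cphase_bound kappa phi (S n) d)).
      apply Rle_trans with (1 := Rplus_le_compat _ _ _ _ IH Ht).
      assert (0 < / 32 ^ n) by (apply Rinv_0_lt_compat, pow_lt; lra).
      simpl; rewrite Rinv_mult; lra. }
  apply Rle_trans with (1 := Hn N (le_n N)).
  assert (0 < / 32 ^ N) by (apply Rinv_0_lt_compat, pow_lt; lra). lra.
Qed.

Lemma wave'_leading (kappa s B phi : R) (N : nat) (d : R) :
  admissible kappa s B -> cutoff B N <= d ->
  Rabs (sqrt d * wave wterm' kappa s phi N d / kappa + sin (kappa * d + phi)) <= / 10.
Proof.
  intros HA Hd.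
  destruct (HA) as (Hk & [Hs _] & HB & HC).
  assert (Hc := cutoff_ge B N HB).
  assert (H0d : 0 < d) by lra.
  (* The relative size of differentiating the power instead of the phase; 1/16 comes from
     [1 <= 2 kappa B] and the factor 32 in the cutoff. *)
  assert (Hsmall : forall n, (n <= N)%nat -> 0 <= (INR n + / 2) / (kappa * d) <= / 16).
  { intros n Hn; split.
    - assert (A := pos_INR n); apply Rmult_le_pos; [lra|].
      left; apply Rinv_0_lt_compat; nra.
    - apply Rle_div_l; [nra|]. apply le_INR in Hn.
      unfold cutoff in Hd. assert (A := pos_INR n).
      assert (1 <= 2 * (kappa * B)) by nra.
      assert (kappa * (32 * B * (INR N + 1)) <= kappa * d) by (apply Rmult_le_compat_l; lra).
      assert (INR N + 1 <= 2 * (kappa * B) * (INR N + 1)) by nra. lra. }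
  (* The leading term errs by its amplitude derivative, at most 1/16; each later order has both
     derivatives, hence the factor [1 + 1/16]. *)
  assert (Hn : forall n, (n <= N)%nat ->
    Rabs (sqrt d * wave wterm' kappa s phi n d / kappa + sin (kappa * d + phi))
      <= / 16 + 17 / 16 * (/ 31 * (1 - / 32 ^ n))).
  { induction n as [|n IH]; intros Hn.
    - unfold wave, wterm', acoeff, cphase, sphase; simpl.
      replace (kappa * d + phi - 0 * (PI / 2)) with (kappa * d + phi) by ring.
      rewrite hpow_S by easy.
      replace (_ + _) with ((sqrt d * hpow 0 d) * (- ((0 + / 2) / (kappa * d))) * cos (kappa * d + phi)
         + (1 - sqrt d * hpow 0 d) * sin (kappa * d + phi)) by (field; lra).
      rewrite sqrt_hpow by easy; simpl; rewrite Rinv_1, Rminus_diag, Rmult_0_l, Rplus_0_r, Rmult_1_l.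
      apply Rle_trans with (/ 16 * 1); [|lra].
      apply Rabs_mult_le; [|apply Rabs_le, COS_bound].
      rewrite Rabs_Ropp; assert (H := Hsmall 0%nat ltac:(lia)); simpl in H.
      rewrite Rabs_pos_eq; easy.
    - unfold wave in *; rewrite tech5.
      specialize (IH ltac:(lia)).
      set (S0 := sum_f_R0 _ _) in *.
      replace (_ + _) with ((sqrt d * S0 / kappa + sin (kappa * d + phi))
        + acoeff kappa s (S n) / d ^ S n *
          (- ((INR (S n) + / 2) / (kappa * d)) * cphase kappa phi (S n) d
           + - sphase kappa phi (S n) d)).
      2:{ unfold wterm'; rewrite (hpow_S (S n)) by easy.
          unfold Rdiv at 2; rewrite <- sqrt_hpow by easy. field; lra. }
      apply Rle_trans with (1 := Rabs_triang _ _).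
      assert (Hp : Rabs (- ((INR (S n) + / 2) / (kappa * d)) * cphase kappa phi (S n) d
           + - sphase kappa phi (S n) d) <= 17 / 16).
      { apply Rle_trans with (1 := Rabs_triang _ _).
        rewrite Rabs_Ropp.
        assert (Hsn := Hsmall (S n) Hn).
        assert (H1 : Rabs (- ((INR (S n) + / 2) / (kappa * d))) <= / 16)
          by (rewrite Rabs_Ropp, Rabs_pos_eq; easy).
        assert (H2 := Rabs_mult_le _ _ _ _ H1 (cphase_bound kappa phi (S n) d)).
        assert (H3 := sphase_bound kappa phi (S n) d). lra. }
      assert (Ht := Rabs_mult_le _ _ _ _
        (acoeff_decay kappa s B N (S n) d HA ltac:(lia) Hd) Hp).
      apply Rle_trans with (1 := Rplus_le_compat _ _ _ _ IH Ht).
      assert (0 < / 32 ^ n) by (apply Rinv_0_lt_compat, pow_lt; lra).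
      simpl pow; rewrite Rinv_mult; lra. }
  apply Rle_trans with (1 := Hn N (le_n N)).
  assert (0 < / 32 ^ N) by (apply Rinv_0_lt_compat, pow_lt; lra). lra.
Qed.

(** * Matching of the Cauchy data and the approximation error *)

(** For the pure cosine and sine the determinant is [c^2 + t^2 = 1]; the stated tolerances move it
    by less than 0.28. *)
Lemma wronskian_lower_bound (c t v w v' w' : R) :
  c ^ 2 + t ^ 2 = 1 ->
  Rabs (v - c) <= / 30 -> Rabs (w - t) <= / 30 ->
  Rabs (v' + t) <= / 10 -> Rabs (w' - c) <= / 10 ->
  / 2 <= v * w' - w * v'.
Proof.
  intros H Hv Hw Hv' Hw'.
  assert (Hc : Rabs c <= 1) by (apply Rabs_le; split; nra).
  assert (Ht : Rabs t <= 1) by (apply Rabs_le; split; nra).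
  replace (v * w' - w * v') with
    (1 + (c * (w' - c) + (v - c) * c + (v - c) * (w' - c)
          - t * (v' + t) + (w - t) * t - (w - t) * (v' + t))).
  2:{ rewrite <- H; ring. }
  assert (B1 := Rabs_mult_le _ _ _ _ Hc Hw').
  assert (B2 := Rabs_mult_le _ _ _ _ Hv Hc).
  assert (B3 := Rabs_mult_le _ _ _ _ Hv Hw').
  assert (B4 := Rabs_mult_le _ _ _ _ Ht Hv').
  assert (B5 := Rabs_mult_le _ _ _ _ Hw Ht).
  assert (B6 := Rabs_mult_le _ _ _ _ Hw Hv').
  apply Rabs_le_between in B1, B2, B3, B4, B5, B6. lra.
Qed.

(* Cramer's rule; [q] is the square root of the matching point, which normalises the
   [d^(-1/2)] decay of the two formal solutions [V] and [W]. *)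
Lemma cauchy_data_match (kappa q U c t V W V' W' F F' : R) :
  0 < kappa -> 0 < q -> 0 <= U ->
  c ^ 2 + t ^ 2 = 1 ->
  Rabs (q * V - c) <= / 30 -> Rabs (q * W - t) <= / 30 ->
  Rabs (q * V' / kappa + t) <= / 10 -> Rabs (q * W' / kappa - c) <= / 10 ->
  Rabs F <= U -> Rabs (F' / kappa) <= U ->
  exists c1 c2,
    Rabs c1 <= 5 * U * q /\ Rabs c2 <= 5 * U * q /\
    c1 * V + c2 * W = F /\ c1 * V' + c2 * W' = F'.
Proof.
  intros Hk Hq HU H Hv Hw Hv' Hw' HF HF'.
  assert (Hdet := wronskian_lower_bound _ _ _ _ _ _ H Hv Hw Hv' Hw').
  assert (Hc : Rabs c <= 1) by (apply Rabs_le; split; nra).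
  assert (Ht : Rabs t <= 1) by (apply Rabs_le; split; nra).
  set (v := q * V) in *. set (w := q * W) in *.
  set (v' := q * V' / kappa) in *. set (w' := q * W' / kappa) in *.
  set (f' := F' / kappa) in *. set (det := v * w' - w * v') in *.
  assert (Bv : Rabs v <= 5 / 4) by (apply Rabs_le_between in Hv, Hc; apply Rabs_le; lra).
  assert (Bw : Rabs w <= 5 / 4) by (apply Rabs_le_between in Hw, Ht; apply Rabs_le; lra).
  assert (Bv' : Rabs v' <= 5 / 4) by (apply Rabs_le_between in Hv', Ht; apply Rabs_le; lra).
  assert (Bw' : Rabs w' <= 5 / 4) by (apply Rabs_le_between in Hw', Hc; apply Rabs_le; lra).
  (* Each Cramer numerator is at most [2 (5/4) U], and the determinant is at least 1/2: hence
     [5 U]. *)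
  assert (Hb : forall a b, Rabs a <= 5 / 4 -> Rabs b <= 5 / 4 ->
    Rabs (q * (F * a - f' * b) / det) <= 5 * U * q).
  { intros a b Ha Hb.
    unfold Rdiv; rewrite Rabs_mult, (Rabs_pos_eq (/ det)) by (left; apply Rinv_0_lt_compat; lra).
    apply Rle_div_l; [lra|].
    rewrite Rabs_mult, (Rabs_pos_eq q) by lra.
    assert (Rabs (F * a - f' * b) <= 5 / 2 * U).
    { assert (A1 := Rabs_mult_le _ _ _ _ HF Ha). assert (A2 := Rabs_mult_le _ _ _ _ HF' Hb).
      apply Rabs_le_between in A1, A2. apply Rabs_le; lra. }
    apply Rle_trans with (q * (5 / 2 * U)); [apply Rmult_le_compat_l; lra|].
    assert (0 <= (det - / 2) * (U * q)); [apply Rmult_le_pos; [lra|nra]|]. lra. }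
  (* The signs in the second witness give it the shape covered by [Hb]. *)
  exists (q * (F * w' - f' * w) / det), (q * (F * - v' - f' * - v) / det).
  split; [now apply Hb|]. split; [apply Hb; now rewrite Rabs_Ropp|].
  assert (EV : V = v / q) by (unfold v; field; lra).
  assert (EW : W = w / q) by (unfold w; field; lra).
  assert (EV' : V' = v' * kappa / q) by (unfold v'; field; lra).
  assert (EW' : W' = w' * kappa / q) by (unfold w'; field; lra).
  assert (EF' : F' = f' * kappa) by (unfold f'; field; lra).
  rewrite EV, EW, EV', EW', EF'.
  assert (det <> 0) by lra.
  split; apply Rmult_eq_reg_l with det; try easy; field_simplify; try (split; lra); try lra;
    unfold det; field; lra.
Qed.

Lemma INR_S_le_pow2 (N : nat) : INR N + 1 <= 2 ^ N.
Proof.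
  induction N as [|N IH]; [simpl; lra|].
  rewrite S_INR; simpl pow; assert (A := pos_INR N); lra.
Qed.

(** What remains of the operator is of order [N]: at most a constant times
    [(N+1)^2 gev B (N+1) d^(-N-1/2) d]. The factor [sqrt (cutoff B N)] anticipates the size of the
    matching coefficients, and the trailing [d] is the growth that [forced_ode_bound] accepts. *)
Lemma wave_residual_bound (kappa s B phi : R) (N : nat) (d : R) :
  admissible kappa s B -> cutoff B N <= d ->
  sqrt (cutoff B N) *
  Rabs (d * (d ^ 2 + s) * wave wterm'' kappa s phi N d
        + (d ^ 2 - s) * wave wterm' kappa s phi N d
        + kappa ^ 2 * d ^ 3 * wave wterm kappa s phi N d)
  <= (2 * kappa + 2 * kappa * s + 4 * s) * B / 4 ^ N * d.
Proof.
  intros HA Hd.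
  destruct (HA) as (Hk & [Hs _] & HB & HC).
  assert (HD := cutoff_ge B N HB). set (D := cutoff B N) in *.
  assert (H0d : 0 < d) by lra.
  rewrite wave_residual by easy.
  destruct (acoeff_bound kappa s B N) as (A1 & A2 & _); try easy.
  destruct (acoeff_bound kappa s B (S N)) as (A3 & _); try easy.
  assert (HN := pos_INR N).
  assert (Hg : 0 < gev B N) by (apply gev_pos; lra).
  assert (Hg1 : gev B N <= gev B (S N)).
  { rewrite gev_S; assert (1 <= B * (INR N + 1)) by nra. nra. }
  assert (A4 : Rabs ((INR N - / 2) * (INR N + 3 / 2) * acoeff_prev kappa s N)
               <= (INR N + 1) * gev B N).
  { destruct N as [|N'].
    - change (acoeff_prev kappa s 0) with 0; rewrite Rmult_0_r, Rabs_R0.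
      simpl; lra.
    - set (n := S N') in *. assert (1 <= INR n) by (apply (le_INR 1); unfold n; lia).
      rewrite Rabs_mult, (Rabs_pos_eq (_ * _)) by nra.
      apply Rle_trans with ((INR n + 1) * (INR n * Rabs (acoeff_prev kappa s n))).
      + rewrite <- Rmult_assoc; apply Rmult_le_compat_r; [apply Rabs_pos|nra].
      + apply Rmult_le_compat_l; lra. }
  set (C := cphase kappa phi N d). set (S_ := sphase kappa phi N d).
  assert (HCb : Rabs C <= 1) by apply cphase_bound.
  assert (HSb : Rabs S_ <= 1) by apply sphase_bound.
  set (G := gev B (S N)) in *.
  set (n2 := (INR N + 1) ^ 2).
  assert (Hn2 : INR N + 1 <= n2) by (unfold n2; nra).
  assert (Hn2G : 0 < n2 * G) by (apply Rmult_lt_0_compat; lra).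
  assert (HnG : (INR N + 1) * G <= n2 * G) by (apply Rmult_le_compat_r; lra).
  assert (Hng : (INR N + 1) * gev B N <= n2 * G) by (apply Rmult_le_compat; lra).
  assert (T1 : Rabs (2 * kappa * (INR N + 1) * acoeff kappa s (S N) * d) <= 2 * kappa * (n2 * G) * d).
  { replace (2 * kappa * (INR N + 1) * acoeff kappa s (S N) * d)
      with ((2 * kappa * d) * ((INR N + 1) * acoeff kappa s (S N))) by ring.
    replace (2 * kappa * (n2 * G) * d) with ((2 * kappa * d) * (n2 * G)) by ring.
    rewrite Rabs_mult, (Rabs_pos_eq (2 * kappa * d)) by (apply Rmult_le_pos; lra).
    apply Rmult_le_compat_l; [apply Rmult_le_pos; lra|].
    rewrite Rabs_mult, (Rabs_pos_eq (INR N + 1)) by lra.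
    apply Rle_trans with (2 := HnG); apply Rmult_le_compat_l; lra. }
  assert (T2 : Rabs (s * (INR N + / 2) * (INR N + 5 / 2) * acoeff kappa s N / d) <= 3 * s * (n2 * G) * d).
  { replace (s * (INR N + / 2) * (INR N + 5 / 2) * acoeff kappa s N / d)
      with (s * ((INR N + / 2) * (INR N + 5 / 2) * acoeff kappa s N) * / d) by (field; lra).
    rewrite Rabs_mult, (Rabs_pos_eq (/ d)) by (left; now apply Rinv_0_lt_compat).
    apply Rmult_le_compat; [apply Rabs_pos | left; now apply Rinv_0_lt_compat | |].
    - rewrite Rabs_mult, (Rabs_pos_eq s) by easy.
      replace (3 * s * (n2 * G)) with (s * (3 * n2 * G)) by ring.
      apply Rmult_le_compat_l; [easy|].
      apply Rabs_mult_le; [rewrite Rabs_pos_eq by nra; unfold n2; nra | lra].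
    - apply Rle_trans with 1; [|lra].
      rewrite <- Rinv_1; apply Rinv_le_contravar; lra. }
  assert (T3 : Rabs (2 * kappa * s * (INR N + 1) * acoeff kappa s N) <= 2 * kappa * s * (n2 * G)).
  { replace (2 * kappa * s * (INR N + 1) * acoeff kappa s N)
      with ((2 * kappa * s) * ((INR N + 1) * acoeff kappa s N)) by ring.
    assert (0 <= kappa * s) by nra.
    rewrite Rabs_mult, (Rabs_pos_eq (2 * kappa * s)) by lra.
    apply Rmult_le_compat_l; [lra|].
    rewrite Rabs_mult, (Rabs_pos_eq (INR N + 1)) by lra.
    apply Rle_trans with (2 := Hng); apply Rmult_le_compat_l; lra. }
  assert (T4 : Rabs (s * (INR N - / 2) * (INR N + 3 / 2) * acoeff_prev kappa s N) <= s * (n2 * G)).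
  { replace (s * (INR N - / 2) * (INR N + 3 / 2) * acoeff_prev kappa s N)
      with (s * ((INR N - / 2) * (INR N + 3 / 2) * acoeff_prev kappa s N)) by ring.
    rewrite Rabs_mult, (Rabs_pos_eq s) by easy.
    apply Rmult_le_compat_l; lra. }
  set (t1 := 2 * kappa * (INR N + 1) * acoeff kappa s (S N) * d) in *.
  set (t2 := s * (INR N + / 2) * (INR N + 5 / 2) * acoeff kappa s N / d) in *.
  set (t3 := 2 * kappa * s * (INR N + 1) * acoeff kappa s N) in *.
  set (t4 := s * (INR N - / 2) * (INR N + 3 / 2) * acoeff_prev kappa s N) in *.
  set (K1 := 2 * kappa + 2 * kappa * s + 4 * s).
  assert (T : Rabs ((t1 + t2) * C + (t3 - t4) * S_) <= K1 * (n2 * G) * d).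
  { assert (R1 : Rabs (t1 + t2) <= 2 * kappa * (n2 * G) * d + 3 * s * (n2 * G) * d)
      by (apply Rle_trans with (1 := Rabs_triang _ _); lra).
    assert (R2 : Rabs (t3 - t4) <= (2 * kappa * s + s) * (n2 * G) * d).
    { apply Rle_trans with (Rabs t3 + Rabs t4).
      - unfold Rminus; apply Rle_trans with (1 := Rabs_triang _ _).
        rewrite Rabs_Ropp; lra.
      - assert (0 <= (2 * kappa * s + s) * (n2 * G)).
        { apply Rmult_le_pos; [assert (0 <= kappa * s) by nra; lra|lra]. }
        nra. }
    apply Rle_trans with (1 := Rabs_triang _ _).
    assert (Q1 := Rabs_mult_le _ _ _ _ R1 HCb). assert (Q2 := Rabs_mult_le _ _ _ _ R2 HSb).
    unfold K1; lra. }
  assert (HK1 : 0 <= K1) by (unfold K1; assert (0 <= kappa * s) by nra; lra).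
  assert (Hh := hpow_pos N d H0d).
  rewrite Rabs_mult, (Rabs_pos_eq (hpow N d)) by lra.
  rewrite <- Rmult_assoc.
  apply Rle_trans with ((/ D ^ N) * (K1 * (n2 * G) * d)).
  { apply Rmult_le_compat; [|apply Rabs_pos| |easy].
    - apply Rmult_le_pos; [apply sqrt_pos|lra].
    - rewrite <- sqrt_hpow by lra.
      apply Rmult_le_compat_l; [apply sqrt_pos|apply hpow_antitone; lra]. }
  apply Rle_trans with (K1 * ((INR N + 1) ^ 3 * B / 32 ^ N) * d).
  { replace (/ D ^ N * (K1 * (n2 * G) * d)) with (K1 * (n2 * (G / D ^ N)) * d)
      by (field; apply pow_nonzero; lra).
    apply Rmult_le_compat_r; [lra|]. apply Rmult_le_compat_l; [easy|].
    replace ((INR N + 1) ^ 3 * B / 32 ^ N) with (n2 * (B * (INR N + 1) / 32 ^ N))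
      by (unfold n2; field; apply pow_nonzero; lra).
    apply Rmult_le_compat_l; [lra|].
    assert (HDN : 0 < D ^ N) by (apply pow_lt; lra).
    apply Rle_div_l; [easy|].
    assert (HG := gev_le_pow B N (S N) ltac:(lra) (le_n _)). fold G in HG.
    apply Rle_trans with (1 := HG).
    unfold D, cutoff. replace (32 * B * (INR N + 1)) with (32 * (B * (INR N + 1))) by ring.
    rewrite (Rpow_mult_distr 32). simpl pow.
    right; field; apply pow_nonzero; lra. }
  apply Rmult_le_compat_r; [lra|].
  replace (K1 * B / 4 ^ N) with (K1 * (B / 4 ^ N)) by (field; apply pow_nonzero; lra).
  apply Rmult_le_compat_l; [easy|].
  (* The polynomial factor uses up 8 of the 32 = 8 * 4. *)
  assert (HP : (INR N + 1) ^ 3 <= 8 ^ N).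
  { replace 8 with (2 ^ 3) by ring. rewrite <- pow_mult, Nat.mul_comm, pow_mult.
    apply pow_incr; split; [lra|apply INR_S_le_pow2]. }
  assert (H4 : 0 < 4 ^ N) by (apply pow_lt; lra).
  assert (H8 : 0 < 8 ^ N) by (apply pow_lt; lra).
  replace (32 ^ N) with (8 ^ N * 4 ^ N) by (rewrite <- Rpow_mult_distr; f_equal; ring).
  apply Rle_trans with (8 ^ N * B / (8 ^ N * 4 ^ N)).
  - apply Rmult_le_compat_r; [left; apply Rinv_0_lt_compat; nra|].
    apply Rmult_le_compat_r; lra.
  - right; field; lra.
Qed.

(** The phases 0 and [- PI/2] give a cosine-like and a sine-like wave. Once they are combined to
    match [F] at the cutoff, the difference starts from zero data and is driven by the residuals
    alone; two coefficients of size [5 U sqrt D] make the factor [10 U]. *)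
Lemma shifted_asymptotics (u u' : R -> R) (kappa s B U : R) (N : nat) :
  bessel_solution u u' -> admissible kappa s B -> 0 <= U ->
  (forall x, kappa <= x -> Rabs (u x) <= U /\ Rabs (u' x) <= U) ->
  exists c1 c2,
    Rabs c1 <= 5 * U * sqrt (cutoff B N) /\ Rabs c2 <= 5 * U * sqrt (cutoff B N) /\
    forall d, cutoff B N <= d ->
      Rabs (shifted u kappa s d
            - (c1 * wave wterm kappa s 0 N d + c2 * wave wterm kappa s (- (PI / 2)) N d))
      <= 10 * U * ((2 * kappa + 2 * kappa * s + 4 * s) * B / 4 ^ N)
         * exp (kappa * s + 1) / kappa.
Proof.
  intros Hu HA HU HB.
  destruct (HA) as (Hk & [Hs Hs4] & HB1 & HC).
  assert (HD := cutoff_ge B N HB1). set (D := cutoff B N) in *.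
  assert (Hq : 0 < sqrt D) by (apply sqrt_lt_R0; lra).
  assert (Hr : D <= sqrt (D ^ 2 + s)).
  { rewrite <- (sqrt_pow2 D) at 1 by lra. apply sqrt_le_1_alt; lra. }
  assert (Hkr : kappa <= kappa * sqrt (D ^ 2 + s)) by nra.
  destruct (HB _ Hkr) as [HF HF'].
  destruct (cauchy_data_match kappa (sqrt D) U (cos (kappa * D)) (sin (kappa * D))
    (wave wterm kappa s 0 N D) (wave wterm kappa s (- (PI / 2)) N D)
    (wave wterm' kappa s 0 N D) (wave wterm' kappa s (- (PI / 2)) N D)
    (shifted u kappa s D) (shifted' u' kappa s D)) as (c1 & c2 & Hc1 & Hc2 & E1 & E2); try easy.
  - rewrite <- !Rsqr_pow2, Rplus_comm; apply sin2_cos2.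
  - assert (H := wave_leading kappa s B 0 N D HA (Rle_refl _)).
    now rewrite Rplus_0_r in H.
  - assert (H := wave_leading kappa s B (- (PI / 2)) N D HA (Rle_refl _)).
    rewrite <- cos_shift. rewrite <- (cos_neg (PI / 2 - _)).
    now replace (- (PI / 2 - kappa * D)) with (kappa * D + - (PI / 2)) by ring.
  - assert (H := wave'_leading kappa s B 0 N D HA (Rle_refl _)).
    now rewrite Rplus_0_r in H.
  - assert (H := wave'_leading kappa s B (- (PI / 2)) N D HA (Rle_refl _)).
    rewrite <- (sin_shift (kappa * D)). unfold Rminus at 1. rewrite <- sin_neg.
    now replace (- (PI / 2 - kappa * D)) with (kappa * D + - (PI / 2)) by ring.
  - unfold shifted'.
    replace (kappa * D * u' (kappa * sqrt (D ^ 2 + s)) / sqrt (D ^ 2 + s) / kappa)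
      with (D / sqrt (D ^ 2 + s) * u' (kappa * sqrt (D ^ 2 + s))) by (field; lra).
    rewrite <- (Rmult_1_l U); apply Rabs_mult_le; [|easy].
    rewrite Rabs_pos_eq; [apply Rle_div_l; lra|].
    apply Rmult_le_pos; [lra|left; apply Rinv_0_lt_compat; lra].
  - exists c1, c2; split; [easy|]; split; [easy|].
    (* The operator of [shifted_ode] applied to one wave. It annihilates [F], so the forcing of the
       difference is minus the combination of the two residuals. *)
    set (res := fun phi d => d * (d ^ 2 + s) * wave wterm'' kappa s phi N d
        + (d ^ 2 - s) * wave wterm' kappa s phi N d
        + kappa ^ 2 * d ^ 3 * wave wterm kappa s phi N d).
    set (comb := fun (f : R -> R -> nat -> R -> R) d =>
      c1 * wave f kappa s 0 N d + c2 * wave f kappa s (- (PI / 2)) N d).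
    apply (forced_ode_bound kappa s D _
      (fun d => shifted u kappa s d - comb wterm d)
      (fun d => shifted' u' kappa s d - comb wterm' d)
      (fun d => - (c1 * res 0 d + c2 * res (- (PI / 2)) d))).
    + easy.
    + nra.
    + lra.
    + apply Rmult_le_pos; [lra|]. apply Rmult_le_pos.
      * assert (0 <= kappa * s) by nra. apply Rmult_le_pos; lra.
      * left; apply Rinv_0_lt_compat, pow_lt; lra.
    + intros d Hd; apply @is_derive_minus; [apply shifted_ode; try easy; lra|].
      apply @is_derive_plus; apply is_derive_scal, is_derive_wave; intros k;
        apply is_derive_wterm; lra.
    + intros d Hd.
      evar_last.
      * apply @is_derive_minus; [apply (shifted_ode u u'); try easy; lra|].
        apply @is_derive_plus; apply is_derive_scal, is_derive_wave; intros k;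
          apply is_derive_wterm'; lra.
      * unfold minus, plus, opp; simpl; unfold res, comb.
        field; split; first [lra | nra].
    + intros d Hd.
      assert (R1 := wave_residual_bound kappa s B 0 N d HA Hd).
      assert (R2 := wave_residual_bound kappa s B (- (PI / 2)) N d HA Hd).
      fold (res 0 d) in R1. fold (res (- (PI / 2)) d) in R2. fold D in R1, R2.
      rewrite Rabs_Ropp.
      apply Rle_trans with (1 := Rabs_triang _ _).
      rewrite !Rabs_mult.
      assert (Q : forall c r, Rabs c <= 5 * U * sqrt D ->
        sqrt D * Rabs r <= (2 * kappa + 2 * kappa * s + 4 * s) * B / 4 ^ N * d ->
        Rabs c * Rabs r <= 5 * U * ((2 * kappa + 2 * kappa * s + 4 * s) * B / 4 ^ N * d)).
      { intros c r H1 H2.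
        apply Rle_trans with (5 * U * sqrt D * Rabs r);
          [apply Rmult_le_compat_r; [apply Rabs_pos|easy]|].
        rewrite Rmult_assoc; apply Rmult_le_compat_l; lra. }
      assert (Q1 := Q _ _ Hc1 R1). assert (Q2 := Q _ _ Hc2 R2). lra.
    + unfold comb; lra.
    + unfold comb; lra.
Qed.

(** * Approximate rank *)

Lemma binomial_le_pow2 (n p : nat) : (p <= n)%nat -> Binomial.C n p <= 2 ^ n.
Proof.
  revert p; induction n as [|n IH]; intros p Hp.
  - replace p with 0%nat by lia. unfold Binomial.C; simpl; lra.
  - assert (H1 : 1 <= 2 ^ S n) by (apply pow_R1_Rle; lra).
    destruct p as [|p]; [|destruct (Nat.eq_dec p n) as [->|Hn]].
    + unfold Binomial.C; rewrite Nat.sub_0_r; change (INR (fact 0)) with 1.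
      unfold Rdiv; rewrite Rmult_1_l, Rinv_r by apply INR_fact_neq_0; easy.
    + unfold Binomial.C; rewrite Nat.sub_diag; change (INR (fact 0)) with 1.
      unfold Rdiv; rewrite Rmult_1_r, Rinv_r by apply INR_fact_neq_0; easy.
    + rewrite <- pascal by lia.
      assert (A1 := IH p ltac:(lia)). assert (A2 := IH (S p) ltac:(lia)).
      simpl pow; lra.
Qed.

(** The Pochhammer symbol [(k + 1/2)_m], which the [m]-th derivative of [d^(-k-1/2)] produces up to
    sign. *)
Fixpoint rising_half (k m : nat) : R :=
  match m with
  | O => 1
  | S m => rising_half k m * (INR k + / 2 + INR m)
  end.

Lemma rising_half_pos (k m : nat) : 0 < rising_half k m.
Proof.
  induction m as [|m IH]; simpl; [lra|].
  assert (A := pos_INR k). assert (B := pos_INR m). nra.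
Qed.

(** Replacing 1/2 by 1 in every factor turns the symbol into [(k+m)! / k!], so the quotient is at
    most a binomial coefficient. *)
Lemma rising_half_bound (k m : nat) :
  rising_half k m / INR (fact m) <= 2 ^ (k + m).
Proof.
  assert (H : rising_half k m * INR (fact k) <= INR (fact (k + m))).
  { induction m as [|m IH].
    - rewrite Nat.add_0_r; simpl; lra.
    - rewrite Nat.add_succ_r, fact_S_R, plus_INR; simpl.
      assert (A := pos_INR k). assert (B := pos_INR m).
      assert (C := INR_fact_lt_0 (k + m)). nra. }
  assert (Hb := binomial_le_pow2 (k + m) m ltac:(lia)).
  apply Rle_trans with (2 := Hb).
  unfold Binomial.C. replace (k + m - m)%nat with k by lia.
  assert (A := INR_fact_lt_0 k). assert (B := INR_fact_lt_0 m).
  replace (rising_half k m / INR (fact m))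
    with (rising_half k m * INR (fact k) / (INR (fact m) * INR (fact k))) by (field; lra).
  apply Rmult_le_compat_r; [|easy].
  left; apply Rinv_0_lt_compat; nra.
Qed.

Lemma is_derive_n_hpow (k m : nat) (x : R) : 0 < x ->
  is_derive_n (hpow k) m x ((-1) ^ m * rising_half k m * hpow (k + m) x).
Proof.
  revert x; induction m as [|m IH]; intros x Hx.
  - simpl; rewrite Nat.add_0_r; ring.
  - simpl is_derive_n.
    apply (is_derive_ext_loc (fun t => (-1) ^ m * rising_half k m * hpow (k + m) t)).
    + apply (locally_interval _ x 0 p_infty); [exact Hx|easy|].
      intros t Ht _; symmetry; apply is_derive_n_unique, IH, Ht.
    + evar_last; [apply is_derive_scal, is_derive_hpow, Hx|].
      rewrite plus_INR, Nat.add_succ_r; simpl. ring.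
Qed.

(** In the Lagrange remainder [a - a0 <= a0 / 4], while the intermediate point exceeds [a0] whatever
    [b >= 0] is. The power quotient is thus at most [4^(-N-1)], against [2^(k+N+1)] from
    [rising_half_bound]; the ratio 5/4 leaves one factor 1/2 per Taylor order. *)
Lemma hpow_taylor (k N : nat) (a0 a b : R) :
  0 < a0 < a -> a <= 5 / 4 * a0 -> 0 <= b ->
  Rabs (hpow k (a + b)
        - sum_f_R0 (fun m => (a - a0) ^ m *
            ((-1) ^ m * rising_half k m * hpow (k + m) (a0 + b) / INR (fact m))) N)
  <= 2 ^ k / 2 ^ S N * hpow k a0.
Proof.
  intros Ha Ha' Hb.
  destruct (Taylor_Lagrange (hpow k) N (a0 + b) (a + b)) as (z & Hz & E); [lra| |].
  { intros t Ht m _; destruct m as [|m]; [easy|].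
    eexists; apply (is_derive_n_hpow k (S m)); lra. }
  rewrite E.
  rewrite (sum_eq _ (fun m => (a - a0) ^ m *
            ((-1) ^ m * rising_half k m * hpow (k + m) (a0 + b) / INR (fact m)))).
  2:{ intros m _.
      rewrite (is_derive_n_unique _ _ _ _ (is_derive_n_hpow k m (a0 + b) ltac:(lra))).
      replace (a + b - (a0 + b)) with (a - a0) by ring. field; apply INR_fact_neq_0. }
  replace (a + b - (a0 + b)) with (a - a0) by ring.
  set (M := S N).
  match goal with |- Rabs (?p + ?q - ?p') <= _ => replace (p + q - p') with q by ring end.
  rewrite (is_derive_n_unique _ _ _ _ (is_derive_n_hpow k M z ltac:(lra))).
  replace ((a - a0) ^ M / INR (fact M) * ((-1) ^ M * rising_half k M * hpow (k + M) z))
    with ((-1) ^ M * ((a - a0) ^ M * hpow (k + M) z * (rising_half k M / INR (fact M))))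
    by (field; apply INR_fact_neq_0).
  rewrite Rabs_mult, pow_1_abs, Rmult_1_l.
  assert (Hh : forall t, 0 < t -> hpow (k + M) t = hpow k t / t ^ M).
  { intros t Ht; assert (A := sqrt_lt_R0 _ Ht). assert (A' := pow_lt _ M Ht).
    assert (A'' := pow_lt _ k Ht).
    unfold hpow; rewrite pow_add; field; lra. }
  assert (P1 : 0 <= (a - a0) ^ M) by (apply pow_le; lra).
  assert (P2 := hpow_pos (k + M) z ltac:(lra)).
  assert (P3 := rising_half_pos k M). assert (P4 := INR_fact_lt_0 M).
  assert (P5 : 0 <= rising_half k M / INR (fact M)).
  { apply Rmult_le_pos; [lra|left; now apply Rinv_0_lt_compat]. }
  rewrite Rabs_pos_eq by (apply Rmult_le_pos; [apply Rmult_le_pos; lra|easy]).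
  apply Rle_trans with ((/ 4 ^ M * hpow k a0) * 2 ^ (k + M)).
  - apply Rmult_le_compat; [apply Rmult_le_pos; lra|easy| |apply rising_half_bound].
    apply Rle_trans with ((a0 / 4) ^ M * hpow (k + M) a0).
    + apply Rmult_le_compat; [easy|lra|apply pow_incr; lra|apply hpow_antitone; lra].
    + rewrite Hh by lra. unfold Rdiv; rewrite Rpow_mult_distr, pow_inv.
      right; field; split; apply pow_nonzero; lra.
  - rewrite pow_add. replace 4 with (2 * 2) by ring. rewrite Rpow_mult_distr.
    right; field; apply pow_nonzero; lra.
Qed.

(** * Calculus of entrywise approximate ranks *)

Definition approx_rank {X Y : Type} (S : X -> Prop) (T : Y -> Prop)
    (n : nat) (eps : R) (f : X -> Y -> C) : Prop :=
  exists (alpha : nat -> X -> C) (beta : nat -> Y -> C),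
    forall x y, S x -> T y ->
      Cmod (f x y - sum_n_m (fun r => (alpha r x * beta r y)%C) 1 n)%C <= eps.

Lemma approx_rank_weaken {X Y} (S S' : X -> Prop) (T : Y -> Prop) n eps eps' (f g : X -> Y -> C) :
  approx_rank S T n eps f -> (forall x, S' x -> S x) -> eps <= eps' ->
  (forall x y, S' x -> T y -> f x y = g x y) -> approx_rank S' T n eps' g.
Proof.
  intros (al & be & H) HS He Hfg; exists al, be; intros x y Hx Hy.
  rewrite <- Hfg by easy. apply Rle_trans with (2 := He). apply H; auto.
Qed.

Lemma approx_rank_perturb {X Y} (S : X -> Prop) (T : Y -> Prop) n eps eps' (f g : X -> Y -> C) :
  approx_rank S T n eps f ->
  (forall x y, S x -> T y -> Cmod (g x y - f x y)%C <= eps') ->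
  approx_rank S T n (eps' + eps) g.
Proof.
  intros (al & be & H) Hfg; exists al, be; intros x y Hx Hy.
  specialize (H x y Hx Hy). specialize (Hfg x y Hx Hy).
  set (A := sum_n_m _ _ _) in *.
  replace (g x y - A)%C with ((g x y - f x y) + (f x y - A))%C by ring.
  apply Rle_trans with (1 := Cmod_triangle _ _). lra.
Qed.

Lemma approx_rank_one {X Y} (S : X -> Prop) (T : Y -> Prop) (p : X -> C) (q : Y -> C) :
  approx_rank S T 1 0 (fun x y => (p x * q y)%C).
Proof.
  exists (fun _ => p), (fun _ => q); intros x y _ _.
  rewrite sum_n_n.
  replace (p x * q y - p x * q y)%C with (RtoC 0) by ring. rewrite Cmod_0; lra.
Qed.

Lemma sum_n_m_concat (u v : nat -> C) (n m : nat) :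
  sum_n_m (fun r => if (r <=? n)%nat then u r else v (r - n)%nat) 1 (n + m)
  = (sum_n_m u 1 n + sum_n_m v 1 m)%C.
Proof.
  induction m as [|m IH].
  - rewrite Nat.add_0_r, (sum_n_m_zero v) by lia.
    transitivity (sum_n_m u 1 n); [|symmetry; apply Cplus_0_r].
    apply sum_n_m_ext_loc; intros r Hr.
    now replace (r <=? n)%nat with true by (symmetry; apply Nat.leb_le; lia).
  - rewrite Nat.add_succ_r, !sum_n_Sm, IH by lia.
    replace (S (n + m) <=? n)%nat with false by (symmetry; apply Nat.leb_gt; lia).
    replace (S (n + m) - n)%nat with (S m) by lia.
    symmetry; apply Cplus_assoc.
Qed.

Lemma approx_rank_plus {X Y} (S : X -> Prop) (T : Y -> Prop) n1 n2 e1 e2 (f1 f2 : X -> Y -> C) :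
  approx_rank S T n1 e1 f1 -> approx_rank S T n2 e2 f2 ->
  approx_rank S T (n1 + n2) (e1 + e2) (fun x y => (f1 x y + f2 x y)%C).
Proof.
  intros (a1 & b1 & H1) (a2 & b2 & H2).
  exists (fun r => if (r <=? n1)%nat then a1 r else a2 (r - n1)%nat),
         (fun r => if (r <=? n1)%nat then b1 r else b2 (r - n1)%nat).
  intros x y Hx Hy. specialize (H1 x y Hx Hy). specialize (H2 x y Hx Hy).
  rewrite (sum_n_m_ext _ (fun r => if (r <=? n1)%nat then (a1 r x * b1 r y)%C
    else (a2 (r - n1)%nat x * b2 (r - n1)%nat y)%C)).
  2:{ intros r; now destruct (r <=? n1)%nat. }
  rewrite (sum_n_m_concat (fun r => (a1 r x * b1 r y)%C) (fun r => (a2 r x * b2 r y)%C)).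
  set (A := sum_n_m _ 1 n1) in *. set (B := sum_n_m _ 1 n2) in *.
  replace (f1 x y + f2 x y - (A + B))%C with ((f1 x y - A) + (f2 x y - B))%C by ring.
  apply Rle_trans with (1 := Cmod_triangle _ _). lra.
Qed.

Lemma sum_n_m_Cmult_l (c : C) (u : nat -> C) (n m : nat) :
  sum_n_m (fun r => (c * u r)%C) n m = (c * sum_n_m u n m)%C.
Proof. exact (sum_n_m_mult_l (K := C_Ring) c u n m). Qed.

Lemma Cmult_interchange (p q a b : C) : ((p * a) * (q * b))%C = ((p * q) * (a * b))%C.
Proof. ring. Qed.

(** A separable multiplier is absorbed into the factors, so the rank stays the same; this is how
    oscillating phases are carried along. *)
Lemma approx_rank_mult {X Y} (S : X -> Prop) (T : Y -> Prop) n eps (f : X -> Y -> C)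
    (p : X -> C) (q : Y -> C) (Q : R) :
  approx_rank S T n eps f ->
  (forall x y, Cmod (p x * q y) <= Q) ->
  approx_rank S T n (Q * eps) (fun x y => (p x * q y * f x y)%C).
Proof.
  intros (a & b & H) HQ.
  exists (fun r x => (p x * a r x)%C), (fun r y => (q y * b r y)%C).
  intros x y Hx Hy. specialize (H x y Hx Hy).
  rewrite (sum_n_m_ext _ (fun r => ((p x * q y) * (a r x * b r y))%C)).
  2:{ intros r; apply Cmult_interchange. }
  rewrite (sum_n_m_Cmult_l (p x * q y)%C).
  set (A := sum_n_m _ 1 n) in *.
  replace (p x * q y * f x y - p x * q y * A)%C with ((p x * q y) * (f x y - A))%C by ring.
  rewrite Cmod_mult. apply Rmult_le_compat; try apply Cmod_ge_0; auto.
Qed.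

Lemma approx_rank_scal {X Y} (S : X -> Prop) (T : Y -> Prop) n eps (f : X -> Y -> C) (c : C) :
  approx_rank S T n eps f ->
  approx_rank S T n (Cmod c * eps) (fun x y => (c * f x y)%C).
Proof.
  intros H.
  apply (approx_rank_weaken _ S _ _ _ _ _ _
    (approx_rank_mult S T n eps f (fun _ => c) (fun _ => RtoC 1) (Cmod c) H
      (fun x y => ltac:(rewrite Cmult_1_r; apply Rle_refl)))); auto.
  - apply Rle_refl.
  - intros; now rewrite Cmult_1_r.
Qed.

Lemma approx_rank_sum {X Y} (S : X -> Prop) (T : Y -> Prop) n (e : nat -> R)
    (f : nat -> X -> Y -> R) (N : nat) :
  (forall k, (k <= N)%nat -> approx_rank S T n (e k) (fun x y => RtoC (f k x y))) ->
  approx_rank S T (Datatypes.S N * n) (sum_f_R0 e N)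
    (fun x y => RtoC (sum_f_R0 (fun k => f k x y) N)).
Proof.
  induction N as [|N IH]; intros H.
  - simpl; rewrite Nat.add_0_r; now apply (H 0%nat).
  - rewrite tech5.
    replace (Datatypes.S (Datatypes.S N) * n)%nat with (Datatypes.S N * n + n)%nat by lia.
    assert (H1 := IH ltac:(intros k Hk; apply H; lia)).
    assert (H2 := H (Datatypes.S N) (le_n _)).
    apply (approx_rank_weaken _ S _ _ _ _ _ _ (approx_rank_plus S T _ _ _ _ _ _ H1 H2)); auto.
    + apply Rle_refl.
    + intros; now rewrite tech5, RtoC_plus.
Qed.

(* The two row sets may overlap: the factors are cut off by the indicator of [S1] and of its complement. *)
Lemma approx_rank_union {X Y} (S1 S2 : X -> Prop) (T : Y -> Prop) n1 n2 eps (f : X -> Y -> C) :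
  approx_rank S1 T n1 eps f -> approx_rank S2 T n2 eps f ->
  approx_rank (fun x => S1 x \/ S2 x) T (n1 + n2) eps f.
Proof.
  intros (a1 & b1 & H1) (a2 & b2 & H2).
  set (chi := fun x => if excluded_middle_informative (S1 x) then RtoC 1 else RtoC 0).
  exists (fun r x => if (r <=? n1)%nat then (chi x * a1 r x)%C
                     else ((RtoC 1 - chi x) * a2 (r - n1)%nat x)%C),
         (fun r => if (r <=? n1)%nat then b1 r else b2 (r - n1)%nat).
  intros x y Hx Hy.
  rewrite (sum_n_m_ext _ (fun r => if (r <=? n1)%nat then (chi x * (a1 r x * b1 r y))%C
    else ((RtoC 1 - chi x) * (a2 (r - n1)%nat x * b2 (r - n1)%nat y))%C)).
  2:{ intros r; destruct (r <=? n1)%nat; symmetry; apply Cmult_assoc. }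
  rewrite (sum_n_m_concat (fun r => (chi x * (a1 r x * b1 r y))%C)
    (fun r => ((RtoC 1 - chi x) * (a2 r x * b2 r y))%C)).
  rewrite (sum_n_m_Cmult_l (chi x)), (sum_n_m_Cmult_l (RtoC 1 - chi x)%C).
  unfold chi; destruct (excluded_middle_informative (S1 x)) as [Hs|Hs].
  - specialize (H1 x y Hs Hy). set (A := sum_n_m _ 1 n1) in *.
    match goal with |- Cmod ?z <= _ => replace z with (f x y - A)%C by ring end. easy.
  - destruct Hx as [Hx|Hx]; [easy|].
    specialize (H2 x y Hx Hy). set (A := sum_n_m _ 1 n1) in *.
    match goal with |- Cmod ?z <= _ =>
      match type of H2 with Cmod ?w <= _ => replace z with w by ring end end. easy.
Qed.

(** One indicator function per value of [a]. It serves the rows below the cutoff, and the whole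
    matrix when the parameters are outside the asymptotic range. *)
Lemma approx_rank_rows {X Y} (T : Y -> Prop) (a : X -> R) (g : R -> Y -> C) (n : nat) :
  approx_rank (fun x => exists i, (1 <= i <= n)%nat /\ a x = INR i) T n 0
    (fun x y => g (a x) y).
Proof.
  induction n as [|n IH].
  - exists (fun _ _ => RtoC 0), (fun _ _ => RtoC 0); intros x y [i [Hi _]]; lia.
  - assert (H1 : approx_rank (fun x => a x = INR (S n)) T 1 0 (fun x y => g (a x) y)).
    { apply (approx_rank_weaken _ _ _ _ _ _ _ _
        (approx_rank_one (fun x => a x = INR (S n)) T (fun _ => RtoC 1) (g (INR (S n)))));
        auto using Rle_refl.
      intros x y -> _; ring. }
    rewrite <- (Nat.add_1_r n) in *.
    apply (approx_rank_weaken _ _ _ _ _ _ _ _ (approx_rank_union _ _ _ _ _ _ _ IH H1));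
      auto using Rle_refl.
    intros x [i [Hi E]].
    destruct (Nat.eq_dec i (n + 1)) as [->|Hn]; [now right|left].
    exists i; split; [lia|easy].
Qed.

(** A union of row sets adds the ranks and keeps [eps], so the number of strips does not enter the
    error. *)
Lemma approx_rank_strips {X Y} (T : Y -> Prop) (a : X -> R) (q D : R) n eps (f : X -> Y -> C) (J : nat) :
  1 <= q -> 0 <= D ->
  (forall a0, D <= a0 -> approx_rank (fun x => a0 < a x <= q * a0) T n eps f) ->
  approx_rank (fun x => D < a x <= D * q ^ J) T (J * n) eps f.
Proof.
  intros Hq HD H; induction J as [|J IH].
  - exists (fun _ _ => RtoC 0), (fun _ _ => RtoC 0); intros x y [H1 H2]; simpl in H2; lra.
  - assert (Hp : D <= D * q ^ J).
    { assert (1 <= q ^ J) by (apply pow_R1_Rle; lra). nra. }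
    replace (S J * n)%nat with (J * n + n)%nat by lia.
    apply (approx_rank_weaken _ _ _ _ _ _ _ _ (approx_rank_union _ _ _ _ _ _ _ IH (H _ Hp)));
      auto using Rle_refl.
    intros x [H1 H2]; simpl in H2.
    destruct (Rle_dec (a x) (D * q ^ J)) as [H3|H3]; [left; lra|right].
    replace (q * (D * q ^ J)) with (D * (q * q ^ J)) by ring. lra.
Qed.

(** * Rank of the expansion on one strip *)

Definition strip {X : Type} (a : X -> R) (a0 : R) (x : X) : Prop := a0 < a x <= 5 / 4 * a0.

Lemma sum_f_R0_zero (N : nat) : sum_f_R0 (fun _ => 0) N = 0.
Proof. rewrite sum_cte; ring. Qed.

Lemma approx_rank_hpow {X Y} (a : X -> R) (b : Y -> R) (a0 : R) (k N : nat) :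
  0 < a0 ->
  approx_rank (strip a a0) (fun y => 0 <= b y) (S N) (2 ^ k / 2 ^ S N * hpow k a0)
    (fun x y => RtoC (hpow k (a x + b y))).
Proof.
  intros Ha0.
  set (c := fun m y => (-1) ^ m * rising_half k m * hpow (k + m) (a0 + b y) / INR (fact m)).
  assert (H := approx_rank_sum (strip a a0) (fun y => 0 <= b y) 1 (fun _ => 0)
    (fun m x y => (a x - a0) ^ m * c m y) N).
  rewrite Nat.mul_1_r, sum_f_R0_zero in H.
  rewrite <- (Rplus_0_r (2 ^ k / 2 ^ S N * hpow k a0)).
  eapply approx_rank_perturb; [apply H|].
  - intros m _.
    apply (approx_rank_weaken _ (strip a a0) _ _ _ _ _ _ (approx_rank_one (strip a a0)
      (fun y => 0 <= b y) (fun x => RtoC ((a x - a0) ^ m)) (fun y => RtoC (c m y))));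
      auto using Rle_refl.
    intros; now rewrite <- RtoC_mult.
  - intros x y [H1 H2] Hy.
    rewrite <- RtoC_minus, Cmod_R.
    apply hpow_taylor; lra.
Qed.

(** The addition theorem for the cosine splits the phase into two separable products, which doubles
    both the rank and the error of [hpow]. *)
Lemma approx_rank_wterm {X Y} (a : X -> R) (b : Y -> R) (kappa phi a0 : R) (k N : nat) :
  0 < a0 ->
  approx_rank (strip a a0) (fun y => 0 <= b y) (2 * S N) (2 ^ k / 2 ^ N * hpow k a0)
    (fun x y => RtoC (wterm kappa phi k (a x + b y))).
Proof.
  intros Ha0.
  set (ph := fun y => kappa * b y + phi - INR k * (PI / 2)).
  assert (Hle : forall u v, Rabs u <= 1 -> Rabs v <= 1 -> Cmod (RtoC u * RtoC v) <= 1).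
  { intros u v Hu Hv; rewrite <- RtoC_mult, Cmod_R.
    rewrite <- (Rmult_1_r 1); now apply Rabs_mult_le. }
  assert (H := approx_rank_hpow a b a0 k N Ha0).
  assert (H1 := approx_rank_mult _ _ _ _ _ (fun x => RtoC (cos (kappa * a x)))
    (fun y => RtoC (cos (ph y))) 1 H
    ltac:(intros; apply Hle; apply Rabs_le, COS_bound)).
  assert (H2 := approx_rank_mult _ _ _ _ _ (fun x => RtoC (- sin (kappa * a x)))
    (fun y => RtoC (sin (ph y))) 1 H
    ltac:(intros; apply Hle; [rewrite Rabs_Ropp|]; apply Rabs_le, SIN_bound)).
  replace (2 * S N)%nat with (S N + S N)%nat by lia.
  apply (approx_rank_weaken _ _ _ _ _ _ _ _ (approx_rank_plus _ _ _ _ _ _ _ _ H1 H2)); auto.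
  - right; simpl pow; field; apply pow_nonzero; lra.
  - intros x y _ _.
    rewrite <- !RtoC_mult, <- RtoC_plus; f_equal.
    unfold wterm, cphase.
    replace (kappa * (a x + b y) + phi - INR k * (PI / 2)) with (kappa * a x + ph y)
      by (unfold ph; ring).
    rewrite cos_plus; ring.
Qed.

Lemma sum_geom_bound (N : nat) : sum_f_R0 (fun k => / 16 ^ k) N <= 2 - / 16 ^ N.
Proof.
  induction N as [|N IH]; [simpl; lra|].
  rewrite tech5.
  assert (0 < / 16 ^ N) by (apply Rinv_0_lt_compat, pow_lt; lra).
  simpl pow; rewrite Rinv_mult; lra.
Qed.

(** The Taylor loss [2^k] meets the decay [32^(-k)] of the coefficients, and [16^(-k)] sums to less
    than 2. The square root is kept in the error in order to cancel the size of the matching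
    coefficients. *)
Lemma approx_rank_wave {X Y} (a : X -> R) (b : Y -> R) (kappa s B phi a0 : R) (N : nat) :
  admissible kappa s B -> cutoff B N <= a0 ->
  approx_rank (strip a a0) (fun y => 0 <= b y) (S N * (2 * S N))
    (2 / (2 ^ N * sqrt (cutoff B N)))
    (fun x y => RtoC (wave wterm kappa s phi N (a x + b y))).
Proof.
  intros HA Ha0.
  assert (HD : 32 <= cutoff B N) by (destruct HA as (_ & _ & HB & _); now apply cutoff_ge).
  assert (H0 : 0 < a0) by lra.
  assert (H := approx_rank_sum (strip a a0) (fun y => 0 <= b y) (2 * S N)
    (fun k => Cmod (RtoC (acoeff kappa s k)) * (2 ^ k / 2 ^ N * hpow k a0))
    (fun k x y => acoeff kappa s k * wterm kappa phi k (a x + b y)) N).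
  apply (approx_rank_weaken _ (strip a a0) _ _ _ _ _
     (fun x y => RtoC (wave wterm kappa s phi N (a x + b y))) (H ltac:(
    intros k _;
    apply (approx_rank_weaken _ (strip a a0) _ _ _ _ _ _ (approx_rank_scal _ _ _ _ _
      (RtoC (acoeff kappa s k)) (approx_rank_wterm a b kappa phi a0 k N H0)));
    auto using Rle_refl; intros; now rewrite <- RtoC_mult))); auto.
  assert (H2 : 0 < 2 ^ N) by (apply pow_lt; lra).
  assert (Hs : 0 < sqrt (cutoff B N)) by (apply sqrt_lt_R0; lra).
  assert (Hs0 : sqrt (cutoff B N) <= sqrt a0) by now apply sqrt_le_1_alt.
  apply Rle_trans with (/ (2 ^ N * sqrt (cutoff B N)) * sum_f_R0 (fun k => / 16 ^ k) N).
  - rewrite scal_sum; apply sum_Rle; intros k Hk.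
    assert (H1 := acoeff_decay kappa s B N k a0 HA ltac:(lia) Ha0).
    assert (Hak : 0 < a0 ^ k) by now apply pow_lt.
    rewrite Cmod_R.
    unfold Rdiv in H1; rewrite Rabs_mult, (Rabs_pos_eq (/ _)) in H1 by (left; now apply Rinv_0_lt_compat).
    replace (Rabs (acoeff kappa s k) * (2 ^ k / 2 ^ N * hpow k a0))
      with ((Rabs (acoeff kappa s k) * / a0 ^ k) * 2 ^ k * / (2 ^ N * sqrt a0)).
    2:{ rewrite <- sqrt_hpow by easy. field; split; [lra|lra]. }
    apply Rmult_le_compat.
    + apply Rmult_le_pos; [|apply pow_le; lra].
      apply Rmult_le_pos; [apply Rabs_pos|left; now apply Rinv_0_lt_compat].
    + left; apply Rinv_0_lt_compat, Rmult_lt_0_compat; lra.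
    + apply Rle_trans with (/ 32 ^ k * 2 ^ k); [apply Rmult_le_compat_r; [apply pow_le; lra|easy]|].
      replace 32 with (16 * 2) by ring. rewrite Rpow_mult_distr.
      right; field; split; apply pow_nonzero; lra.
    + apply Rinv_le_contravar; [now apply Rmult_lt_0_compat|].
      apply Rmult_le_compat_l; lra.
  - unfold Rdiv; rewrite (Rmult_comm 2).
    apply Rmult_le_compat_l; [left; apply Rinv_0_lt_compat, Rmult_lt_0_compat; lra|].
    assert (A := sum_geom_bound N).
    assert (0 < / 16 ^ N) by (apply Rinv_0_lt_compat, pow_lt; lra). lra.
Qed.

(** [20 U] comes from the two waves, each weighted by at most [5 U sqrt D]; the other summand is the
    bound of [shifted_asymptotics] with [kappa <= k2], [s <= 4] and [1/kappa <= 1/k1]. It is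
    independent of [N]. *)
Definition strip_const (k1 k2 B U : R) : R :=
  20 * U + 10 * U * ((2 * k2 + 2 * k2 * 4 + 4 * 4) * B) * exp (k2 * 4 + 1) / k1.

Lemma approx_rank_shifted {X Y} (a : X -> R) (b : Y -> R) (u u' : R -> R)
    (k1 k2 kappa s B U a0 : R) (N : nat) :
  bessel_solution u u' -> admissible kappa s B -> 0 < k1 -> k1 <= kappa <= k2 -> 0 <= U ->
  (forall x, k1 <= x -> Rabs (u x) <= U /\ Rabs (u' x) <= U) ->
  cutoff B N <= a0 ->
  approx_rank (strip a a0) (fun y => 0 <= b y) (2 * (S N * (2 * S N)))
    (strip_const k1 k2 B U / 2 ^ N)
    (fun x y => RtoC (shifted u kappa s (a x + b y))).
Proof.
  intros Hu HA Hk1 Hk HU HB Ha0.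
  destruct (shifted_asymptotics u u' kappa s B U N Hu HA HU) as (c1 & c2 & Hc1 & Hc2 & Hc).
  { intros x Hx; apply HB; lra. }
  destruct (HA) as (_ & Hs & HB1 & _).
  assert (HD : 32 <= cutoff B N) by now apply cutoff_ge.
  assert (Hq : 0 < sqrt (cutoff B N)) by (apply sqrt_lt_R0; lra).
  assert (H2 : 0 < 2 ^ N) by (apply pow_lt; lra).
  assert (H24 : 2 ^ N <= 4 ^ N) by (apply pow_incr; lra).
  assert (W1 := approx_rank_scal _ _ _ _ _ (RtoC c1) (approx_rank_wave a b kappa s B 0 a0 N HA Ha0)).
  assert (W2 := approx_rank_scal _ _ _ _ _ (RtoC c2) (approx_rank_wave a b kappa s B (- (PI / 2)) a0 N HA Ha0)).
  assert (W := approx_rank_plus _ _ _ _ _ _ _ _ W1 W2).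
  apply approx_rank_perturb with
    (g := fun x y => RtoC (shifted u kappa s (a x + b y)))
    (eps' := 10 * U * ((2 * kappa + 2 * kappa * s + 4 * s) * B / 4 ^ N)
         * exp (kappa * s + 1) / kappa) in W.
  - replace (2 * (S N * (2 * S N)))%nat with (S N * (2 * S N) + S N * (2 * S N))%nat by lia.
    apply (approx_rank_weaken _ _ _ _ _ _ _ _ W); auto.
    assert (Hcc : forall c, Rabs c <= 5 * U * sqrt (cutoff B N) ->
      Cmod (RtoC c) * (2 / (2 ^ N * sqrt (cutoff B N))) <= 10 * U / 2 ^ N).
    { intros c Hcb; rewrite Cmod_R.
      apply Rle_trans with (5 * U * sqrt (cutoff B N) * (2 / (2 ^ N * sqrt (cutoff B N)))).
      - apply Rmult_le_compat_r; [|easy].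
        apply Rmult_le_pos; [lra|left; apply Rinv_0_lt_compat, Rmult_lt_0_compat; lra].
      - right; field; lra. }
    assert (B1 := Hcc _ Hc1). assert (B2 := Hcc _ Hc2).
    assert (B3 : 10 * U * ((2 * kappa + 2 * kappa * s + 4 * s) * B / 4 ^ N)
         * exp (kappa * s + 1) / kappa
      <= 10 * U * ((2 * k2 + 2 * k2 * 4 + 4 * 4) * B) * exp (k2 * 4 + 1) / k1 / 2 ^ N).
    { assert (kappa * s <= k2 * 4) by (apply Rmult_le_compat; lra).
      assert (0 <= kappa * s) by (apply Rmult_le_pos; lra).
      assert (X1 := exp_monotone (kappa * s + 1) (k2 * 4 + 1) ltac:(lra)).
      assert (X2 := exp_pos (kappa * s + 1)).
      assert (Hi : 0 < / kappa <= / k1).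
      { split; [apply Rinv_0_lt_compat; lra|apply Rinv_le_contravar; lra]. }
      assert (Hj : 0 < / 4 ^ N <= / 2 ^ N).
      { split; [apply Rinv_0_lt_compat; lra|apply Rinv_le_contravar; lra]. }
      unfold Rdiv.
      replace (10 * U * ((2 * kappa + 2 * kappa * s + 4 * s) * B * / 4 ^ N) * exp (kappa * s + 1) * / kappa)
        with (10 * U * ((2 * kappa + 2 * kappa * s + 4 * s) * B) * exp (kappa * s + 1) * / kappa * / 4 ^ N)
        by ring.
      assert (Q0 : 0 <= 10 * U * ((2 * kappa + 2 * kappa * s + 4 * s) * B)).
      { apply Rmult_le_pos; [lra|apply Rmult_le_pos; lra]. }
      assert (Q1 : 10 * U * ((2 * kappa + 2 * kappa * s + 4 * s) * B)
                   <= 10 * U * ((2 * k2 + 2 * k2 * 4 + 4 * 4) * B)).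
      { apply Rmult_le_compat_l; [lra|apply Rmult_le_compat_r; lra]. }
      repeat apply Rmult_le_compat; try lra; try easy.
      all: repeat apply Rmult_le_pos; lra. }
    unfold strip_const. rewrite Rdiv_plus_distr. lra.
  - intros x y [Hx _] Hy.
    rewrite <- !RtoC_mult, <- RtoC_plus, <- RtoC_minus, Cmod_R.
    apply Hc; lra.
Qed.

(** * The half-space Green's function *)

(** The [+ 0] makes both terms instances of [shifted]. *)
Definition green_profile (kappa d : R) : C :=
  (hankel0 (kappa * sqrt (d ^ 2 + 0)) - hankel0 (kappa * sqrt (d ^ 2 + 4)))%C.

Lemma Cmod_Ci : Cmod Ci = 1.
Proof.
  unfold Cmod, Ci; simpl.
  replace (0 * (0 * 1) + 1 * (1 * 1)) with 1 by ring. apply sqrt_1.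
Qed.

(** Four pieces, [J0] and [Y0] for [s = 0] and [s = 4], each of rank [4 (N+1)^2] and with a scalar
    factor of modulus 1. *)
Lemma approx_rank_green_profile {X Y} (a : X -> R) (b : Y -> R)
    (k1 k2 kappa B U a0 : R) (N : nat) :
  admissible kappa 0 B -> admissible kappa 4 B -> 0 < k1 -> k1 <= kappa <= k2 -> 0 <= U ->
  (forall x, k1 <= x -> (Rabs (bessel_J0 x) <= U /\ Rabs (J0' x) <= U) /\
                        (Rabs (bessel_Y0 x) <= U /\ Rabs (Y0' x) <= U)) ->
  cutoff B N <= a0 ->
  approx_rank (strip a a0) (fun y => 0 <= b y) (16 * (S N * S N))
    (4 * strip_const k1 k2 B U / 2 ^ N)
    (fun x y => green_profile kappa (a x + b y)).
Proof.
  intros A0 A4 Hk1 Hk HU HB Ha0.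
  assert (HJ := fun s A => approx_rank_shifted a b _ _ k1 k2 kappa s B U a0 N
    bessel_solution_J0 A Hk1 Hk HU (fun x Hx => proj1 (HB x Hx)) Ha0).
  assert (HY := fun s A => approx_rank_shifted a b _ _ k1 k2 kappa s B U a0 N
    bessel_solution_Y0 A Hk1 Hk HU (fun x Hx => proj2 (HB x Hx)) Ha0).
  assert (H := approx_rank_plus _ _ _ _ _ _ _ _
    (approx_rank_plus _ _ _ _ _ _ _ _ (HJ 0 A0) (approx_rank_scal _ _ _ _ _ Ci (HY 0 A0)))
    (approx_rank_plus _ _ _ _ _ _ _ _ (approx_rank_scal _ _ _ _ _ (- RtoC 1)%C (HJ 4 A4))
      (approx_rank_scal _ _ _ _ _ (- Ci)%C (HY 4 A4)))).
  rewrite !Cmod_opp, Cmod_Ci, Cmod_1 in H.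
  match type of H with approx_rank _ _ ?n _ _ =>
    replace n with (16 * (S N * S N))%nat in H by lia end.
  apply (approx_rank_weaken _ _ _ _ _ _ _ _ H); auto.
  - right; field; apply pow_nonzero; lra.
  - intros x y _ _; unfold green_profile, hankel0, shifted.
    set (r0 := kappa * sqrt ((a x + b y) ^ 2 + 0)).
    set (r4 := kappa * sqrt ((a x + b y) ^ 2 + 4)).
    ring.
Qed.

(** Offsets in grid units from column [n/2], the last one of [Y]: [i - n/2] for a row point and
    [n/2 - j] for a column point, with sum [i - j]. *)
Definition row_coord (n : nat) (x : R * R) : R := fst x * (INR n + 1) - INR (n / 2).
Definition col_coord (n : nat) (y : R * R) : R := INR (n / 2) - fst y * (INR n + 1).

Lemma setX_row_coord (n m : nat) (x : R * R) :
  n = (2 * (n / 2))%nat -> setX n m x ->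
  exists i, (1 <= i <= n / 2)%nat /\ row_coord n x = INR i.
Proof.
  intros Hn (i & Hi & ->). exists (i - n / 2)%nat; split; [lia|].
  rewrite minus_INR by lia. unfold row_coord, gridpt, spacing; simpl fst.
  assert (A := pos_INR n). field; lra.
Qed.

Lemma setY_col_coord (n m : nat) (y : R * R) : setY n m y -> 0 <= col_coord n y.
Proof.
  intros (i & Hi & ->). unfold col_coord, gridpt, spacing; simpl fst.
  assert (A := pos_INR n).
  replace (INR i * (1 / (INR n + 1)) * (INR n + 1)) with (INR i) by (field; lra).
  assert (INR i <= INR (n / 2)) by (apply le_INR; lia). lra.
Qed.

(** Both points have height [m h] and the mirror image has height [(m + 2) h]; so [m] cancels, and
    the squared vertical offsets are 0 and 4 in units of [h]. *)
Lemma green_eq_profile (omega : R) (n m : nat) (x y : R * R) :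
  setX n m x -> setY n m y ->
  green omega n m x y
  = green_profile (omega * spacing n) (row_coord n x + col_coord n y).
Proof.
  intros (i & Hi & ->) (j & Hj & ->).
  assert (A := pos_INR n).
  assert (Hh : 0 < spacing n) by (unfold spacing; apply Rdiv_lt_0_compat; lra).
  assert (Hinv : spacing n * (INR n + 1) = 1) by (unfold spacing; field; lra).
  assert (Hd : row_coord n (gridpt n i m) + col_coord n (gridpt n j m) = INR i - INR j).
  { unfold row_coord, col_coord, gridpt; simpl fst.
    transitivity ((INR i - INR j) * (spacing n * (INR n + 1))); [ring|].
    rewrite Hinv; ring. }
  rewrite Hd. unfold green, green_profile, dist2, mirror, dist_euc, gridpt; simpl fst; simpl snd.
  set (h := spacing n) in *.
  assert (Hsq : forall t, 0 <= t -> sqrt (h ^ 2 * t) = h * sqrt t).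
  { intros t Ht. rewrite sqrt_mult by (try apply pow2_ge_0; easy).
    now rewrite sqrt_pow2 by lra. }
  assert (Hp := pow2_ge_0 (INR i - INR j)).
  rewrite !(Rmult_assoc omega h), <- !Hsq by lra.
  f_equal; apply f_equal, f_equal, f_equal; unfold Rsqr; ring.
Qed.

(** For [N] the integer part of [4 l], [ln 2 > 1/2] gives [2^(N+1) >= exp (2 l)]. One factor
    [exp (- l)] is the target accuracy, the other absorbs [2 C]. *)
Lemma exists_order (C l : R) : 1 <= l -> 0 < C -> 2 * C * exp (- l) <= 1 ->
  exists N : nat, C / 2 ^ N <= exp (- l) /\ INR N + 1 <= 5 * l.
Proof.
  intros Hl HC Hsmall.
  destruct (nfloor_ex (4 * l)) as [N HN]; [lra|].
  exists N; split; [|lra].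
  assert (H2 : 0 < 2 ^ N) by (apply pow_lt; lra).
  apply Rle_div_l; [easy|].
  assert (Hp : exp (2 * l) <= 2 * 2 ^ N).
  { change (2 * 2 ^ N) with (2 ^ S N). rewrite <- (exp_ln (2 ^ S N)) by (apply pow_lt; lra).
    apply exp_monotone. rewrite ln_pow by lra. rewrite S_INR.
    assert (A := ln_lt_2). nra. }
  assert (E : exp (- l) * exp (- l) * exp (2 * l) = 1).
  { rewrite <- !exp_plus. replace (- l + - l + 2 * l) with 0 by ring. apply exp_0. }
  assert (P := exp_pos (- l)). assert (P2 := exp_pos (2 * l)).
  set (e := exp (- l)) in *.
  assert (C <= C * (e * e * (2 * 2 ^ N))).
  { rewrite <- (Rmult_1_r C) at 1. apply Rmult_le_compat_l; [lra|].
    rewrite <- E. apply Rmult_le_compat_l; [nra|easy]. }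
  apply Rle_trans with (1 := H).
  replace (C * (e * e * (2 * 2 ^ N))) with ((2 * C * e) * (e * 2 ^ N)) by ring.
  rewrite <- (Rmult_1_l (e * 2 ^ N)) at 2. apply Rmult_le_compat_r; [nra|easy].
Qed.

Theorem theorem2p3 :
  forall pmin pmax : R, 0 < pmin -> pmin <= pmax ->
  exists K omega0 eps0 : R,
    0 < K /\ 1 < omega0 /\ 0 < eps0 < 1 /\
    forall (omega : R) (k n m : nat) (eps : R),
      0 < omega ->
      (1 <= k)%nat -> n = (2 ^ k)%nat ->
      pmin <= points_per_wavelength omega n <= pmax ->
      (1 <= m <= n)%nat ->
      0 < eps ->
      exists (rk : nat) (alpha beta : nat -> R * R -> C),
        (omega0 <= omega -> eps <= eps0 ->
           INR rk <= K * ln omega * Rabs (ln eps) ^ 2) /\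
        forall x y : R * R, setX n m x -> setY n m y ->
          Cmod (green omega n m x y
                - sum_n_m (fun r : nat => (alpha r x * beta r y)%C) 1 rk)%C
            <= eps.
Proof.
  intros pmin pmax Hpmin Hpmax.
  assert (HPI := PI_RGT_0).
  set (k1 := 2 * PI / pmax). set (k2 := 2 * PI / pmin).
  assert (Hk1 : 0 < k1) by (apply Rdiv_lt_0_compat; lra).
  assert (Hk2 : k1 <= k2).
  { apply Rmult_le_compat_l; [lra|apply Rinv_le_contravar; lra]. }
  destruct (bessel_solution_bounded _ _ k1 bessel_solution_J0 Hk1) as (UJ & HUJ & BJ).
  destruct (bessel_solution_bounded _ _ k1 bessel_solution_Y0 Hk1) as (UY & HUY & BY).
  set (U := UJ + UY).
  assert (HB : forall x, k1 <= x -> (Rabs (bessel_J0 x) <= U /\ Rabs (J0' x) <= U) /\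
                        (Rabs (bessel_Y0 x) <= U /\ Rabs (Y0' x) <= U)).
  { intros x Hx; destruct (BJ x Hx), (BY x Hx); unfold U; repeat split; lra. }
  (* The quotient is the worst case of the last inequality in [admissible], at [s = 4] and
     [kappa <= k2] on the left and [kappa >= k1] on the right; the summand 1 ensures [1 <= B]. *)
  set (B := 1 + (9 + 4 * k2 ^ 2 + 8 * k2) / (2 * k1)).
  assert (HB1 : 1 <= B).
  { unfold B; assert (0 <= (9 + 4 * k2 ^ 2 + 8 * k2) / (2 * k1)); [|lra].
    apply Rmult_le_pos; [nra|left; apply Rinv_0_lt_compat; lra]. }
  assert (Hadm : forall kappa s, k1 <= kappa <= k2 -> 0 <= s <= 4 -> admissible kappa s B).
  { intros kappa s Hkap Hs; repeat split; try lra.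
    apply Rle_trans with (2 * k1 * B).
    - replace (2 * k1 * B) with (2 * k1 + (9 + 4 * k2 ^ 2 + 8 * k2)) by (unfold B; field; lra).
      assert (kappa ^ 2 <= k2 ^ 2) by (apply pow_incr; lra).
      assert (kappa ^ 2 * s <= k2 ^ 2 * 4) by (apply Rmult_le_compat; try lra; apply pow2_ge_0).
      assert (kappa * s <= k2 * 4) by (apply Rmult_le_compat; lra). lra.
    - apply Rmult_le_compat_r; lra. }
  set (Ce := 4 * strip_const k1 k2 B U).
  assert (HCe : 0 < Ce).
  { unfold Ce, strip_const.
    assert (0 < U) by (unfold U; lra).
    assert (0 <= 10 * U * ((2 * k2 + 2 * k2 * 4 + 4 * 4) * B) * exp (k2 * 4 + 1) / k1); [|lra].
    assert (P := exp_pos (k2 * 4 + 1)).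
    repeat apply Rmult_le_pos; try lra. left; now apply Rinv_0_lt_compat. }
  (* [160 B] counts the exact rows, 1600 the strips, and 4 converts [k] into [ln omega]. [2 + pmax]
     makes [ln pmax <= ln omega]. In the threshold for [eps], the 3 gives [|ln eps| >= 1] through
     [exp 1 <= 3], and [2 Ce] is the smallness asked by [exists_order]. *)
  exists (4 * (160 * B + 1600)), (2 + pmax), (/ (3 + 2 * Ce)).
  split; [lra|]. split; [lra|].
  split.
  { split; [apply Rinv_0_lt_compat; lra|].
    rewrite <- Rinv_1; apply Rinv_lt_contravar; lra. }
  intros omega k n m eps Hom Hk Hn Hp Hm Heps.
  assert (Hhalf : n = (2 * (n / 2))%nat).
  { destruct k as [|k]; [lia|]. rewrite Hn, Nat.pow_succ_r', Nat.mul_comm, Nat.div_mul; lia. }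
  set (kappa := omega * spacing n).
  assert (HnR := pos_INR n).
  assert (Hpk : points_per_wavelength omega n = 2 * PI / kappa).
  { unfold points_per_wavelength, wavelength, kappa, spacing; field; lra. }
  assert (Hkap0 : 0 < kappa).
  { apply Rmult_lt_0_compat; [easy|]. unfold spacing; apply Rdiv_lt_0_compat; lra. }
  rewrite Hpk in Hp.
  assert (Hkap : k1 <= kappa <= k2).
  { destruct Hp as [Hp1 Hp2]. unfold k1, k2; split.
    - apply Rle_div_l; [lra|]. apply Rle_div_l in Hp2; lra.
    - apply -> (Rle_div_r kappa); [|easy].
      apply <- (Rle_div_r pmin) in Hp1; [|easy]. lra. }
  assert (Hrows := fun r => approx_rank_rows (setY n m) (row_coord n)
    (fun t y => green_profile kappa (t + col_coord n y)) r).
  destruct (excluded_middle_informative (2 + pmax <= omega /\ eps <= / (3 + 2 * Ce)))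
    as [[Ho He]|Hno].
  (* Outside the asymptotic range no bound on the rank is claimed, so all [n/2] rows are kept
     exactly. *)
  2:{ exists (n / 2)%nat.
      destruct (approx_rank_weaken _ (setX n m) _ _ _ eps _ (green omega n m) (Hrows (n / 2)%nat))
        as (al & be & H); [| lra | |].
      - intros x Hx; now apply (setX_row_coord n m).
      - intros x y Hx Hy; symmetry; now apply green_eq_profile.
      - exists al, be; split; [intros; tauto|exact H]. }
  set (l := - ln eps).
  assert (Hel : eps = exp (- l)) by (unfold l; now rewrite Ropp_involutive, exp_ln).
  assert (He3 : eps * (3 + 2 * Ce) <= 1).
  { apply Rmult_le_compat_r with (r := 3 + 2 * Ce) in He; [|lra].
    rewrite Rinv_l in He; lra. }
  assert (Hl : 1 <= l).
  { destruct (Rle_dec 1 l) as [H|H]; [easy|].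
    assert (H1 : exp (- (1)) < eps) by (rewrite Hel; apply exp_increasing; lra).
    rewrite exp_Ropp in H1.
    assert (/ 3 <= / exp 1) by (apply Rinv_le_contravar; [apply exp_pos|apply exp_le_3]).
    assert (0 < eps * Ce) by (apply Rmult_lt_0_compat; lra). lra. }
  destruct (exists_order Ce l Hl HCe) as (N & HN1 & HN2).
  { rewrite <- Hel. nra. }
  rewrite <- Hel in HN1.
  assert (HD := cutoff_ge B N HB1). set (D := cutoff B N) in *.
  destruct (nfloor_ex D) as [r Hr]; [lra|].
  (* Since [(5/4)^4 > 2] and [n = 2^k], [4 k] strips reach beyond [D n >= n]. *)
  assert (Hstrips := approx_rank_strips (setY n m) (row_coord n) (5 / 4) D
    (16 * (S N * S N)) eps (fun x y => green_profile kappa (row_coord n x + col_coord n y))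
    (4 * k) ltac:(lra) ltac:(lra)).
  assert (Hall := approx_rank_union _ _ _ _ _ _ _
    (approx_rank_weaken _ _ _ _ _ eps _ _ (Hrows r) (fun x H => H) ltac:(lra) (fun x y _ _ => eq_refl))
    (Hstrips ltac:(
      intros a0 Ha0;
      destruct (approx_rank_green_profile (row_coord n) (col_coord n) k1 k2 kappa B U a0 N)
        as (al & be & H);
      [apply Hadm; lra | apply Hadm; lra | easy | easy | unfold U; lra | easy | easy |];
      exists al, be; intros x y Hx Hy;
      apply Rle_trans with (2 := HN1);
      apply H; [exact Hx | now apply (setY_col_coord n m)]))).
  destruct (approx_rank_weaken _ (setX n m) _ _ _ eps _ (green omega n m) Hall)
    as (al & be & H); [| lra | |].
  - intros x Hx.
    destruct (setX_row_coord n m x Hhalf Hx) as (i & Hi & Ei).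
    (* [r] is the integer part of [D], so an integer above [r] is above [D]. *)
    destruct (le_lt_dec i r) as [Hir|Hir].
    + left; exists i; split; [lia|easy].
    + right; rewrite Ei; split.
      * apply (le_INR (S r)) in Hir; rewrite S_INR in Hir; lra.
      * assert (Hin : INR i <= 2 ^ k).
        { replace (2 ^ k) with (INR n) by (rewrite Hn, pow_INR; reflexivity).
          apply le_INR; lia. }
        assert (2 ^ k <= (5 / 4) ^ (4 * k)).
        { rewrite pow_mult; apply pow_incr; lra. }
        assert (0 < 2 ^ k) by (apply pow_lt; lra). nra.
  - intros x y Hx Hy; symmetry; now apply green_eq_profile.
  - exists (r + 4 * k * (16 * (S N * S N)))%nat, al, be; split; [intros _ _|exact H].
    rewrite Rabs_left1 by (fold l; unfold l in Hl; lra). fold l.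
    assert (HkR : 1 <= INR k) by now apply (le_INR 1).
    (* The bound on [p] gives [n <= pmax omega], so [k ln 2 = ln n <= 2 ln omega], and
       [ln 2 > 1/2]. *)
    assert (Hlnk : INR k <= 4 * ln omega).
    { assert (Hnom : INR n <= pmax * omega).
      { destruct Hp as [_ Hp2]. apply Rle_div_l in Hp2; [|easy].
        unfold kappa, spacing in Hp2.
        replace (pmax * (omega * (1 / (INR n + 1)))) with (pmax * omega / (INR n + 1)) in Hp2
          by (field; lra).
        apply Rle_div_r in Hp2; [|lra].
        assert (P2 := PI2_3_2). unfold PI2 in P2. nra. }
      assert (E : INR k * ln 2 = ln (INR n)).
      { rewrite Hn, pow_INR. change (INR 2) with 2. rewrite ln_pow; lra. }
      assert (Hn0 : 0 < INR n) by (apply (lt_INR 0); lia).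
      assert (ln (INR n) <= ln (pmax * omega)) by (apply ln_le; lra).
      rewrite ln_mult in H0 by lra.
      assert (ln pmax <= ln omega) by (apply ln_le; lra).
      assert (A := ln_lt_2). nra. }
    rewrite plus_INR, !mult_INR, (S_INR N).
    replace (INR 4) with 4 by (simpl; ring). replace (INR 16) with 16 by (simpl; ring).
    assert (HN0 := pos_INR N).
    (* The exact rows number only [O(l)]; [k >= 1] and [l >= 1] let [k l^2] absorb them. *)
    assert (R1 : INR r <= 160 * B * (INR k * l ^ 2)).
    { apply Rle_trans with (32 * B * (INR N + 1)); [apply Hr|].
      apply Rle_trans with (160 * B * l); [nra|].
      apply Rmult_le_compat_l; [lra|]. nra. }
    assert (R2 : 4 * INR k * (16 * ((INR N + 1) * (INR N + 1))) <= 1600 * (INR k * l ^ 2)).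
    { replace (1600 * (INR k * l ^ 2)) with (4 * INR k * (16 * (5 * l * (5 * l)))) by ring.
      apply Rmult_le_compat_l; [lra|]. apply Rmult_le_compat_l; [lra|].
      apply Rmult_le_compat; lra. }
    apply Rle_trans with ((160 * B + 1600) * (INR k * l ^ 2)); [lra|].
    replace (4 * (160 * B + 1600) * ln omega * l ^ 2)
      with ((160 * B + 1600) * (4 * ln omega * l ^ 2)) by ring.
    apply Rmult_le_compat_l; [lra|].
    apply Rmult_le_compat_r; [apply pow2_ge_0|easy].
Qed.
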